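(* The group $G=BS(1,2)=\langle a,t \mid tat^{-1}=a^2\rangle$ is $M'AC$ with respect to the generating set $A=\{a,a^{-1},t,t^{-1}\}$. In particular, if $w,u\in A^*$ are geodesic words of length $r>200$ with $1\le d(\overline{w},\overline{u})\le 2$, then there is a path $\delta$ inside $B(r)$ from $\overline{w}$ to $\overline{u}$ of length at most $2r-2$.
   Context: For a group $G$ with finite generating set $A$, let $\Gamma$ be the corresponding Cayley graph, regarded as a metric graph with path metric $d$ (each edge has length 1), and let $S(r)$ and $B(r)$ denote the sphere and the (closed) ball of radius $r$ in $\Gamma$ centred at the identity vertex. For a function $f:\mathbb{N}\to\mathbb{R}_+$ and $r_0\in\mathbb{N}$, the pair $(G,A)$ satisfies the condition $AC_{f,r_0}$ if for every natural number $r\ge r_0$ and every pair of vertices $a,b\in S(r)$ with $d(a,b)\le 2$ there is a path inside $B(r)$ from $a$ to $b$ of length at most $f(r)$. The pair $(G,A)$ is $M'AC$ if $AC_{f,r_0}$ holds for the function $f(r)=2r-2$ and some $r_0\in\mathbb{N}$. For a word $w\in A^*$, $\overline{w}$ denotes the element of $G$ (vertex of $\Gamma$) represented by $w$; a word is geodesic if it labels a shortest path in $\Gamma$, i.e. its length equals the distance from $1$ to $\overline{w}$. *)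

(* Defs.v *)
From HB Require Import structures.
From mathcomp Require Import all_boot all_order all_algebra.
From mathcomp Require Import generic_quotient.
From mathcomp Require Import all_classical all_reals.
Set Implicit Arguments.
Unset Strict Implicit.
Unset Printing Implicit Defensive.
Import Order.TTheory GRing.Theory Num.Theory.
Local Open Scope classical_set_scope.
Local Open Scope ring_scope.

(* The letter [(x, false)] is the generator [x] and [(x, true)] its formal
   inverse. *)
Definition gword (X : Type) := seq (X * bool).

Definition gword_inv (X : Type) (u : gword X) : gword X :=
  rev [seq (l.1, ~~ l.2) | l <- u].

(* The congruence on words generated by free cancellation and the relations
   [u = v] for [(u, v)] in [R]. *)
Inductive pres_eq (X : choiceType) (R : seq (gword X * gword X)) :
    gword X -> gword X -> Prop :=
| pres_refl u : pres_eq R u u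
| pres_sym u v : pres_eq R u v -> pres_eq R v u
| pres_trans u v w : pres_eq R u v -> pres_eq R v w -> pres_eq R u w
| pres_cat u u' v v' :
    pres_eq R u u' -> pres_eq R v v' -> pres_eq R (u ++ v) (u' ++ v')
| pres_cancel x e : pres_eq R [:: (x, e); (x, ~~ e)] [::]
| pres_rel u v : (u, v) \in R -> pres_eq R u v.

Section Presentation.
Variables (X : choiceType) (R : seq (gword X * gword X)).

Definition pres_eqb : rel (gword X) := fun u v => `[< pres_eq R u v >].

Lemma pres_eqb_refl : reflexive pres_eqb.
Proof. by move=> u; apply/asboolP; apply: pres_refl. Qed.

Lemma pres_eqb_sym : symmetric pres_eqb.
Proof.
by move=> u v; apply/asboolP/asboolP => uv; apply: pres_sym.
Qed.

Lemma pres_eqb_trans : transitive pres_eqb.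
Proof.
move=> v u w /asboolP uv /asboolP vw; apply/asboolP.
exact: pres_trans uv vw.
Qed.

Canonical pres_equiv := EquivRel pres_eqb
  pres_eqb_refl pres_eqb_sym pres_eqb_trans.

Definition presented := {eq_quot pres_equiv}%qT.

HB.instance Definition _ := Choice.on presented.
HB.instance Definition _ := Quotient.on presented.

Definition pres_class (u : gword X) : presented := (\pi_presented u)%qT.

Lemma pres_classP u v : pres_class u = pres_class v <-> pres_eq R u v.
Proof.
split; first by move=> /eqmodP /asboolP.
by move=> uv; apply/eqmodP/asboolP.
Qed.

Lemma pres_reprK (x : presented) : pres_class (repr x) = x.
Proof. exact: reprK. Qed.

Lemma pres_repr_class u : pres_eq R (repr (pres_class u)) u.
Proof. by apply/pres_classP; rewrite pres_reprK. Qed.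

Definition presented_mul (x y : presented) : presented :=
  pres_class (repr x ++ repr y).
Definition presented_one : presented := pres_class [::].
Definition presented_inv (x : presented) : presented :=
  pres_class (gword_inv (repr x)).

Lemma presented_mulE u v :
  presented_mul (pres_class u) (pres_class v) = pres_class (u ++ v).
Proof. by apply/pres_classP/pres_cat; apply: pres_repr_class. Qed.

Lemma pres_eq_invr u : pres_eq R (u ++ gword_inv u) [::].
Proof.
elim: u => [|[x e] u IHu]; first exact: pres_refl.
rewrite /gword_inv /= rev_cons -cats1 catA.
apply: pres_trans (pres_cancel R x e).
apply: (@pres_cat _ _ [:: (x, e)] [:: (x, e)]); first exact: pres_refl.
exact: (pres_cat IHu (pres_refl _ [:: (x, ~~ e)])).
Qed.

Lemma gword_invK : involutive (@gword_inv X).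
Proof.
move=> u; rewrite /gword_inv map_rev revK -map_comp -[RHS]map_id.
by apply: eq_map => -[x e] /=; rewrite negbK.
Qed.

Lemma pres_eq_invl u : pres_eq R (gword_inv u ++ u) [::].
Proof. by have := pres_eq_invr (gword_inv u); rewrite gword_invK. Qed.

Lemma presented_mulA : associative presented_mul.
Proof.
move=> x y z; rewrite -(pres_reprK x) -(pres_reprK y) -(pres_reprK z).
by rewrite !presented_mulE catA.
Qed.

Lemma presented_mul1 : left_id presented_one presented_mul.
Proof. by move=> x; rewrite -(pres_reprK x) presented_mulE. Qed.

Lemma presented_mulr1 : right_id presented_one presented_mul.
Proof. by move=> x; rewrite -(pres_reprK x) presented_mulE cats0. Qed.

Lemma presented_mulV : left_inverse presented_one presented_inv presented_mul.
Proof.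
move=> x; rewrite -{2}(pres_reprK x) presented_mulE.
exact/pres_classP/pres_eq_invl.
Qed.

Lemma presented_mulrV : right_inverse presented_one presented_inv presented_mul.
Proof.
move=> x; rewrite -{1}(pres_reprK x) presented_mulE.
exact/pres_classP/pres_eq_invr.
Qed.

HB.instance Definition _ := isGroup.Build presented
  presented_mulA presented_mul1 presented_mulr1
  presented_mulV presented_mulrV.

Definition pres_gen (x : X) : presented := pres_class [:: (x, false)].

Lemma pres_classM u v :
  pres_class (u ++ v) = (pres_class u * pres_class v)%g.
Proof. by rewrite -presented_mulE. Qed.

Lemma pres_class_nil : pres_class [::] = 1%g.
Proof. by []. Qed.

Lemma pres_class_inv_gen x : pres_class [:: (x, true)] = ((pres_gen x)^-1)%g.
Proof.
apply: (mulgI (pres_gen x)); rewrite mulgV -pres_classM.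
exact/pres_classP/(pres_cancel _ x false).
Qed.

End Presentation.

Section CayleyGraph.
Variables (G : groupType) (A : seq G).

Definition generates : Prop := forall g : G,
  exists2 w : seq G, {subset w <= A ++ [seq (x^-1)%g | x <- A]}
                   & (\big[*%g/1%g]_(x <- w) x = g)%g.

Definition cayley_adj : rel G :=
  fun g h => ((g^-1 * h)%g \in A) || ((h^-1 * g)%g \in A).

(* [g :: p] lists the successive vertices of an edge path from [g] to [h]; its
   length is [size p]. *)
Definition edge_path (g h : G) (p : seq G) : bool :=
  path cayley_adj g p && (last g p == h).

(* The default value [0] is only taken when no edge path joins [g] to [h],
   which cannot happen when [A] generates [G]. *)
Definition dist (g h : G) : nat :=
  xget 0%N [set n | (exists2 p, edge_path g h p & size p = n) /\
                    (forall q, edge_path g h q -> (n <= size q)%N)].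

Definition sphere (r : nat) : set G := [set g | dist 1%g g = r].

Definition wordval (w : seq G) : G := (\big[*%g/1%g]_(x <- w) x)%g.

Definition word_on (w : seq G) : Prop := {subset w <= A}.

Definition geodesic (w : seq G) : Prop :=
  word_on w /\ size w = dist 1%g (wordval w).

Section Metric.
Variable R : realType.

(* [(u, v, x)] with [0 <= x <= 1] is the point at distance [x] from [u] along
   an edge joining [u] to [v]; a vertex [u] is the point [(u, v, 0)]. *)
Definition edge_points (u v : G) : set (G * G * R) :=
  [set p | p.1 = (u, v) /\ 0 <= p.2 <= 1].

(* Path metric from the identity vertex to a point of the metric graph: a path
   ending inside an edge enters it through one of its two endpoints. *)
Definition dist1_point (p : G * G * R) : R :=
  Num.min ((dist 1%g p.1.1)%:R + p.2) ((dist 1%g p.1.2)%:R + (1 - p.2)).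

(* Being a ball of the metric graph, [ball1 r] does not contain an edge whose
   endpoints are both at distance [r] from the identity: the midpoint of such
   an edge is at distance [r + 1/2]. *)
Definition ball1 (r : nat) : set (G * G * R) :=
  [set p | dist1_point p <= r%:R].

(* Consecutive pairs of vertices of the path [g :: p] are [zip (g :: p) p]. *)
Definition path_in_ball (r : nat) (g : G) (p : seq G) : Prop :=
  forall u v, (u, v) \in zip (g :: p) p -> edge_points u v `<=` ball1 r.

Definition joined_in_ball (r : nat) (l : R) (g h : G) : Prop :=
  exists p : seq G,
    [/\ edge_path g h p, path_in_ball r g p & (size p)%:R <= l].

Definition almost_convex (f : nat -> R) (r0 : nat) : Prop :=
  forall (r : nat) (a b : G), (r0 <= r)%N ->
    sphere r a -> sphere r b -> (dist a b <= 2)%N ->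
    joined_in_ball r (f r) a b.

(* [2 r - 2] is negative at [r = 0] only, and [r0] may always be enlarged. *)
Definition MprimeAC : Prop :=
  exists r0 : nat, almost_convex (fun r => 2 * r%:R - 2) r0.

End Metric.
End CayleyGraph.

Lemma edge_path_adj1 (G : groupType) (A : seq G) (g h x : G) (p : seq G) :
  x \in A ++ [seq (y^-1)%g | y <- A] ->
  edge_path A (g * x)%g h p -> edge_path A g h ((g * x)%g :: p).
Proof.
move=> xA /andP[pp lp]; rewrite /edge_path /= pp lp !andbT /cayley_adj.
rewrite mulKg invgM mulgVK; move: xA; rewrite mem_cat => /orP[->//|].
by case/mapP=> y yA ->; rewrite invgK yA orbT.
Qed.

Lemma dist_spec (G : groupType) (A : seq G) (g h : G) : generates A ->
  (exists2 p, edge_path A g h p & size p = dist A g h) /\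
  (forall q, edge_path A g h q -> (dist A g h <= size q)%N).
Proof.
move=> genA.
have [p0 p0P] : exists p, edge_path A g h p.
  have [w wA wE] := genA (g^-1 * h)%g.
  have -> : h = (g * \big[*%g/1%g]_(x <- w) x)%g by rewrite wE mulVKg.
  clear wE; elim: w g wA => [|x w IHw] g wA.
    by exists [::]; rewrite /edge_path /= big_nil mulg1.
  have [|p pP] := IHw (g * x)%g.
    by move=> y yw; apply: wA; rewrite inE yw orbT.
  exists ((g * x)%g :: p); apply: edge_path_adj1; first exact/wA/mem_head.
  by rewrite big_cons mulgA.
pose P n := `[< exists2 p, edge_path A g h p & size p = n >].
have exP : exists n, P n by exists (size p0); apply/asboolP; exists p0.
rewrite /dist; case: xgetP => [n _ //|/(_ (ex_minn exP))]; case.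
case: ex_minnP => n /asboolP pn minn; split=> // q qP.
by apply: minn; apply/asboolP; exists q.
Qed.

Inductive bs_letter := bs_letter_a | bs_letter_t.

Definition bs_letter_bool (x : bs_letter) : bool :=
  if x is bs_letter_a then true else false.
Definition bs_bool_letter (b : bool) : bs_letter :=
  if b then bs_letter_a else bs_letter_t.
Lemma bs_letter_boolK : cancel bs_letter_bool bs_bool_letter.
Proof. by case. Qed.

HB.instance Definition _ :=
  Choice.copy bs_letter (can_type bs_letter_boolK).

Definition bs12_relation : gword bs_letter * gword bs_letter :=
  ([:: (bs_letter_t, false); (bs_letter_a, false); (bs_letter_t, true)],
   [:: (bs_letter_a, false); (bs_letter_a, false)]).

Definition BS12 : groupType := presented [:: bs12_relation].

Definition bs_a : BS12 := pres_gen [:: bs12_relation] bs_letter_a.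
Definition bs_t : BS12 := pres_gen [:: bs12_relation] bs_letter_t.

Definition bs_gens : seq BS12 := [:: bs_a; bs_a^-1; bs_t; bs_t^-1]%g.

Lemma bs12_relE : (bs_t * bs_a * bs_t^-1 = bs_a ^+ 2)%g.
Proof.
rewrite /bs_t -pres_class_inv_gen expgS expg1 /bs_a /pres_gen.
set R := [:: _].
rewrite -(pres_classM R [:: (bs_letter_t, false)] [:: (bs_letter_a, false)]).
rewrite -(pres_classM R [:: (bs_letter_t, false); (bs_letter_a, false)]).
rewrite -(pres_classM R [:: (bs_letter_a, false)]).
by apply/pres_classP/pres_rel; rewrite inE.
Qed.

Lemma bs_gens_generates : generates bs_gens.
Proof.
move=> g; rewrite -(pres_reprK g); elim: (repr g) => [|l u [w wA wE]].
  by exists [::]; rewrite ?big_nil.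
exists (pres_class [:: bs12_relation] [:: l] :: w); last first.
  by rewrite big_cons wE -pres_classM.
move=> x; rewrite inE => /predU1P[->|/wA//].
rewrite mem_cat; apply/orP; left.
by case: l => -[] [|]; rewrite ?pres_class_inv_gen !inE eqxx ?orbT.
Qed.

(* Main.v *)
Require Import Defs.
From mathcomp Require Import all_boot all_order all_algebra.
From mathcomp Require Import all_classical all_reals.
From mathcomp Require Import zify ring lra.
Import Order.TTheory GRing.Theory Num.Theory.
Set Implicit Arguments.
Unset Strict Implicit.
Unset Printing Implicit Defensive.
Local Open Scope ring_scope.

(* BS(1,2) is the group of pairs (x, k) with x in Z[1/2] and k in Z, where right
   multiplication by a adds 2^k to x and right multiplication by t adds 1 to k.
   Hence the length of (x, k) is the minimum of
     sum |c_i| + 2 (M - m) - |k|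
   over all digit expansions x = sum_(m <= i <= M) c_i 2^i with m <= 0, k <= M: a
   geodesic tours the levels m .. M and collects the digits on its way.
   Minimality makes all digits but the top one at most 1 in absolute value, and
   bounds the top one by 5.
   Let (x, k), (y, l) in S(r) be at distance at most 2. If geodesics to both can
   start with the same letter, the path through that letter has length 2r - 2.
   This fails only if the levels are close to 0, where lowering the top (and
   bottom) digit by one gives a detour inside B(r) of length at most 2r - 2, or if
   they are negative, where the two geodesics come close to each other at a low
   level. *)

(** * The affine model and its walks *)

Definition pow2 (k : int) : rat := 2 ^ k.

Lemma pow2D i j : pow2 (i + j) = pow2 i * pow2 j.
Proof. by rewrite /pow2 expfzDr. Qed.

Lemma pow2_0 : pow2 0 = 1. Proof. by []. Qed.

Lemma pow2_nat (p : nat) : pow2 p%:Z = ((2 : int) ^+ p)%:~R.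
Proof. by rewrite rmorphXn. Qed.

Lemma pow2_gt0 k : 0 < pow2 k.
Proof. by rewrite exprz_gt0. Qed.

Lemma pow2NK k : pow2 k * pow2 (- k) = 1.
Proof. by rewrite -pow2D subrr. Qed.

Lemma pow2S k : pow2 (k + 1) = 2 * pow2 k.
Proof. by rewrite pow2D mulrC. Qed.

(* [(x, k)] is the affine map [z |-> 2 ^ k * z + x]; [a] is [z |-> z + 1], [t] is
   [z |-> 2 * z]. *)
Definition pt := (rat * int)%type.

Definition sgn (e : bool) : int := if e then -1 else 1.

Definition step (P : pt) (s : bs_letter * bool) : pt :=
  match s with
  | (bs_letter_a, e) => (P.1 + (sgn e)%:~R * pow2 P.2, P.2)
  | (bs_letter_t, e) => (P.1, P.2 + sgn e)
  end.

Definition inv_letter (s : bs_letter * bool) := (s.1, ~~ s.2).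

Lemma sgnN e : sgn (~~ e) = - sgn e. Proof. by case: e. Qed.

Lemma stepK P s : step (step P s) (inv_letter s) = P.
Proof.
case: P s => x k [[] e]; rewrite /step /inv_letter /= sgnN; congr pair.
  by rewrite rmorphN; ring.
by rewrite addrK.
Qed.

(** The index only bounds the number of steps, which gives [walk_mono] and leaves length estimates
    to arithmetic. [E] restricts the edges: it is trivial for [reach] and confines [bwalk] to a
    ball. *)
Inductive walk (E : pt -> pt -> Prop) : nat -> pt -> pt -> Prop :=
| walk0 n P : walk E n P P
| walkS n P s Q : E P (step P s) -> walk E n (step P s) Q -> walk E n.+1 P Q.

Section Walk.
Variable E : pt -> pt -> Prop.

Lemma walk_mono n m P Q : walk E n P Q -> (n <= m)%N -> walk E m P Q.
Proof.
move=> w; elim: w m => [n0 P0 m _|{}n {}P s {}Q Es _ IH [//|m] nm].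
  by apply: walk0.
by apply: walkS Es _; apply: IH.
Qed.

Lemma walk_trans n m P Q T :
  walk E n P Q -> walk E m Q T -> walk E (n + m) P T.
Proof.
elim=> [{}n {}P|{}n {}P s {}Q Es _ IH] w.
  by apply: walk_mono w _; rewrite leq_addl.
by rewrite addSn; apply: walkS Es _; apply: IH.
Qed.

Lemma walk1 P s : E P (step P s) -> walk E 1 P (step P s).
Proof. by move=> Es; apply: walkS Es _; apply: walk0. Qed.

Hypothesis Esym : forall P Q, E P Q -> E Q P.

Lemma walk_sym n P Q : walk E n P Q -> walk E n Q P.
Proof.
elim=> [{}n {}P|{}n {}P s {}Q Es _ IH]; first exact: walk0.
rewrite -addn1; apply: walk_trans IH _.
have := @walk1 (step P s) (inv_letter s); rewrite stepK; apply; exact: Esym.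
Qed.

End Walk.

Definition reach := walk (fun _ _ => True).
Definition len_le n P := reach n (0, 0) P.

Lemma reach_sym n P Q : reach n P Q -> reach n Q P.
Proof. exact: walk_sym. Qed.

Lemma len_le_mono n m P : len_le n P -> (n <= m)%N -> len_le m P.
Proof. exact: walk_mono. Qed.

(** A step is a right multiplication, so left multiplication by [(u, j)] is an automorphism of the
    graph. *)
Lemma reach_tr n u j P Q : reach n P Q ->
  reach n (u + pow2 j * P.1, j + P.2) (u + pow2 j * Q.1, j + Q.2).
Proof.
elim=> [{}n {}P|{}n {}P s {}Q _ _ IH]; first exact: walk0.
apply: (@walkS _ _ _ s) => //.
suff -> : step (u + pow2 j * P.1, j + P.2) s =
   (u + pow2 j * (step P s).1, j + (step P s).2) by [].
case: s {IH} => [[] e] /=; congr pair; rewrite ?addrA //.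
by rewrite pow2D; ring.
Qed.

Lemma reach_L n u j x k y l : len_le n (x, k) ->
  y = u + pow2 j * x -> l = j + k -> reach n (u, j) (y, l).
Proof.
move=> /(reach_tr u j) /=; rewrite mulr0 !addr0 => H -> ->; exact: H.
Qed.

Lemma reach_t (i : int) x k l : l = k + i -> reach `|i|%N (x, k) (x, l).
Proof.
move=> ->; case: (i) => n.
  elim: n k => [|n IH] k; first by rewrite addr0; apply: walk0.
  apply: (@walkS _ _ _ (bs_letter_t, false)) => //=.
  have -> : k + n.+1%:Z = k + 1 + n%:Z by lia.
  exact: IH.
elim: n k => [|n IH] k; first exact: (@walkS _ _ _ (bs_letter_t, true)) (walk0 _ _ _).
apply: (@walkS _ _ _ (bs_letter_t, true)) => //=.
have -> : k + Negz n.+1 = k + -1 + Negz n by lia.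
exact: IH.
Qed.

Lemma reach_a (d : int) x k y : y = x + d%:~R * pow2 k -> reach `|d|%N (x, k) (y, k).
Proof.
move=> ->; case: d => n.
  elim: n x => [|n IH] x; first by rewrite mul0r addr0; apply: walk0.
  apply: (@walkS _ _ _ (bs_letter_a, false)) => //=.
  have -> : x + n.+1%:~R * pow2 k = x + 1%:~R * pow2 k + n%:~R * pow2 k.
    by rewrite (_ : n.+1%:Z = 1 + n%:Z) ?intrD; [ring|lia].
  exact: IH.
elim: n x => [|n IH] x.
  exact: (@walkS _ _ _ (bs_letter_a, true)) (walk0 _ _ _).
apply: (@walkS _ _ _ (bs_letter_a, true)) => //=.
have -> : x + (Negz n.+1)%:~R * pow2 k = x + (-1)%:~R * pow2 k + (Negz n)%:~R * pow2 k.
  by rewrite (_ : Negz n.+1 = -1 + Negz n) ?intrD; [ring|lia].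
exact: IH.
Qed.

(* In a path whose vertices are within [r] of the identity, an edge lies in
   [B(r)] as soon as its ends are not both on [S(r)]. *)
Definition inner r u v := len_le r.-1 u \/ len_le r.-1 v.
Definition bwalk r := walk (inner r).

Lemma bwalk_sym r n P Q : bwalk r n P Q -> bwalk r n Q P.
Proof. by apply: walk_sym => ? ? []; [right|left]. Qed.

(** Lengths grow by at most one per step from [i] on, so every step starts at length below [r]. The
    detours are assembled from such pieces, each run from an end whose length is known to be
    small. *)
Lemma bwalk_geo r i n P Q : len_le i P -> reach n P Q -> (i + n <= r)%N -> bwalk r n P Q.
Proof.
move=> LP w; elim: w i LP => [{}n {}P i _ _|{}n {}P s {}Q _ _ IH i LP ir].
  exact: walk0.
apply: (@walkS _ _ _ s); first by left; apply: len_le_mono LP _; lia.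
apply: IH (i.+1) _ _; last by lia.
by rewrite -addn1; apply: walk_trans LP _; apply: walk1.
Qed.

Lemma bwalk_edge r b (d : int) x k y : len_le b (x, k) -> (b < r)%N -> `|d|%N = 1%N ->
  y = x + d%:~R * pow2 k -> bwalk r 1 (x, k) (y, k).
Proof. by move=> Lx br d1 /reach_a; rewrite d1 => w; apply: bwalk_geo Lx w _; lia. Qed.

(** * Digit expansions and word length *)

(* [c i] is the digit of weight [2 ^ (i - n)], where the depth [n] is supplied by
   [rep] below; [N] is the index of the top digit, not the number of digits. *)
Definition dsum (c : nat -> int) (N : nat) : int := \sum_(i < N.+1) c i * 2 ^+ i.
Definition weight (c : nat -> int) (N : nat) : nat := (\sum_(i < N.+1) `|c i|)%N.
Definition upd (c : nat -> int) (p : nat) (d : int) : nat -> int :=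
  fun i => if i == p then c i + d else c i.

Lemma dsum0 c : dsum c 0 = c 0%N.
Proof. by rewrite /dsum big_ord1 expr0 mulr1. Qed.
Lemma weight0 c : weight c 0 = `|c 0%N|%N.
Proof. by rewrite /weight big_ord1. Qed.
Lemma dsum_recr c N : dsum c N.+1 = dsum c N + c N.+1 * 2 ^+ N.+1.
Proof. by rewrite /dsum big_ord_recr. Qed.
Lemma weight_recr c N : weight c N.+1 = (weight c N + `|c N.+1|)%N.
Proof. by rewrite /weight big_ord_recr. Qed.
Lemma dsum_recl c N : dsum c N.+1 = c 0%N + 2 * dsum (c \o succn) N.
Proof.
rewrite /dsum big_ord_recl expr0 mulr1 mulr_sumr; congr (_ + _).
by apply: eq_bigr => i _; rewrite /= /bump /= add1n exprS; ring.
Qed.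
Lemma weight_recl c N : weight c N.+1 = (`|c 0%N| + weight (c \o succn) N)%N.
Proof. by rewrite /weight big_ord_recl. Qed.
Lemma eq_dsum c c' N : (forall i, (i <= N)%N -> c i = c' i) -> dsum c N = dsum c' N.
Proof. by move=> e; apply: eq_bigr => i _; rewrite e // -ltnS. Qed.
Lemma eq_weight c c' N : (forall i, (i <= N)%N -> c i = c' i) -> weight c N = weight c' N.
Proof. by move=> e; apply: eq_bigr => i _; rewrite e // -ltnS. Qed.

Lemma dsum_upd c N p d : (p <= N)%N -> dsum (upd c p d) N = dsum c N + d * 2 ^+ p.
Proof.
move=> pN; have pN' : (p < N.+1)%N by [].
rewrite /dsum (bigD1 (Ordinal pN')) //= [in RHS](bigD1 (Ordinal pN')) //=.
rewrite {1}/upd eqxx (eq_bigr (fun i : 'I_N.+1 => c i * 2 ^+ i)); first by ring.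
by move=> i ip; rewrite /upd ifN.
Qed.

Lemma weight_upd c N p d : (p <= N)%N ->
  (weight (upd c p d) N + `|c p| = weight c N + `|(c p + d)%R|)%N.
Proof.
move=> pN; have pN' : (p < N.+1)%N by [].
rewrite /weight (bigD1 (Ordinal pN')) //= [in RHS](bigD1 (Ordinal pN')) //=.
rewrite {1}/upd eqxx (eq_bigr (fun i : 'I_N.+1 => `|c i|%N)); first by lia.
by move=> i ip; rewrite /upd ifN.
Qed.

Lemma weight_upd_le c N p d : (p <= N)%N -> (weight (upd c p d) N <= weight c N + `|d|)%N.
Proof. by move=> /(weight_upd c d); lia. Qed.

Lemma weight_ge c N p : (p <= N)%N -> (`|c p| <= weight c N)%N.
Proof. by move=> /(weight_upd c (- c p)); lia. Qed.

Lemma weight_ge2 c N p q : (p <= N)%N -> (q <= N)%N -> p != q -> (`|c p| + `|c q| <= weight c N)%N.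
Proof.
move=> pN qN pq; have := weight_upd c (- c p) pN; have := weight_ge (upd c p (- c p)) qN.
by rewrite {1}/upd eq_sym (negPf pq); lia.
Qed.

Lemma dsum_parity c N : exists z, dsum c N = c 0%N + 2 * z.
Proof.
case: N => [|N]; first by exists 0; rewrite dsum0 mulr0 addr0.
by exists (dsum (c \o succn) N); rewrite dsum_recl.
Qed.

Lemma sweep c N x h y l : y = x + (dsum c N)%:~R * pow2 h -> l = h + N%:Z ->
  reach (weight c N + N) (x, h) (y, l).
Proof.
move=> -> ->; elim: N => [|N IH].
  by rewrite dsum0 weight0 addn0 addr0; apply: reach_a.
have -> : (weight c N.+1 + N.+1 = weight c N + N + (1 + `|c N.+1|))%N by rewrite weight_recr; lia.
apply: walk_trans IH _; apply: (@walk_trans _ _ _ _ (x + (dsum c N)%:~R * pow2 h, h + N.+1%:Z)).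
  by apply: (@reach_t 1); lia.
apply: reach_a; rewrite dsum_recr intrD intrM pow2D -pow2_nat; ring.
Qed.

(** Index [i] stands for level [i - n]. The bounds say that the levels include 0 and [P.2], where a
    tour starts and ends. *)
Definition rep c N n (P : pt) := [/\ (n <= N)%N, - n%:Z <= P.2 <= N%:Z - n%:Z
  & P.1 = (dsum c N)%:~R * pow2 (- n%:Z)].

Lemma dsum_opp c N : dsum (fun i => - c i) N = - dsum c N.
Proof. by rewrite /dsum -sumrN; apply: eq_bigr => i _; rewrite mulNr. Qed.

Lemma weight_opp c N : weight (fun i => - c i) N = weight c N.
Proof. by apply: eq_bigr => i _; rewrite abszN. Qed.

(* A shortest tour of the levels [- n .. N - n] from [0] to [k] has length
   [2 * N - `|k|]: it first visits the end opposite to [k]. *)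
Lemma len_le_rep b c N n P : rep c N n P -> (weight c N + 2 * N <= b + `|P.2|)%N -> len_le b P.
Proof.
case: P => x k [/= nN kn ->] cost; set x' := _ * _.
case: (lerP 0 k) => k0.
  have H : reach (n + (weight c N + N) + (N - n - `|k|)) (0, 0) (x', k).
    apply: (@walk_trans _ _ _ _ (x', N%:Z - n%:Z)).
      apply: (@walk_trans _ _ _ _ (0, - n%:Z)).
        by have := @reach_t (- n%:Z) 0 0 (- n%:Z); rewrite abszN; apply; lia.
      by apply: sweep; [rewrite add0r|lia].
    by apply: walk_mono; [apply: (@reach_t (k - (N%:Z - n%:Z)))|]; lia.
  by apply: walk_mono H _; lia.
have H : reach ((N - n) + (weight c N + N) + (n - `|k|)) (0, 0) (x', k).
  apply: (@walk_trans _ _ _ _ (x', - n%:Z)).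
    apply: (@walk_trans _ _ _ _ (0, N%:Z - n%:Z)).
      by apply: walk_mono; [apply: (@reach_t (N%:Z - n%:Z))|]; lia.
    (* Descending is the inverse of a sweep upwards, which collects the opposite digits. *)
    apply: reach_sym; rewrite -weight_opp; apply: sweep; last by lia.
    by rewrite dsum_opp rmorphN /x'; ring.
  by apply: walk_mono; [apply: (@reach_t (k + n%:Z))|]; lia.
by apply: walk_mono H _; lia.
Qed.

Lemma rep_upd c N n x k p d y : rep c N n (x, k) -> (p <= N)%N ->
  y = x + d%:~R * pow2 (p%:Z - n%:Z) -> rep (upd c p d) N n (y, k).
Proof.
move=> [/= nN kn ->] pN ->; split=> //=.
by rewrite dsum_upd // intrD intrM -pow2_nat pow2D; ring.
Qed.

Lemma rep_k c N n x k k' : rep c N n (x, k) -> - n%:Z <= k' <= N%:Z - n%:Z ->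
  rep c N n (x, k').
Proof. by case. Qed.

Lemma pow2_1 : pow2 1 = 2. Proof. by []. Qed.

Lemma rep_bot c N n x k k' : rep c N n (x, k) -> - n.+1%:Z <= k' <= N%:Z - n%:Z ->
  rep (fun i => if i is j.+1 then c j else 0) N.+1 n.+1 (x, k').
Proof.
move=> [/= nN kn ->] kk; split=> //=; first by lia.
rewrite dsum_recl add0r (_ : - n%:Z = 1 - n.+1%:Z); last by lia.
rewrite pow2D pow2_1 intrM; set s := dsum _ N; rewrite (_ : s = dsum c N) //.
by ring.
Qed.

Lemma weight_bot c N : weight (fun i => if i is j.+1 then c j else 0) N.+1 = weight c N.
Proof. by rewrite weight_recl. Qed.

(** Entries of [c] beyond [N] are arbitrary and must be cleared before [N] grows. *)
Definition ext (c : nat -> int) N := fun i => if (i <= N)%N then c i else 0.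
Lemma rep_top c N n x k k' : rep c N n (x, k) -> - n%:Z <= k' <= N.+1%:Z - n%:Z ->
  rep (ext c N) N.+1 n (x, k').
Proof.
move=> [/= nN kn ->] kk; split=> //=; first by lia.
rewrite dsum_recr /ext ltnn mul0r addr0; congr (_%:~R * _); apply: eq_dsum => i ->//.
Qed.

Lemma weight_top c N : weight (ext c N) N.+1 = weight c N.
Proof. by rewrite weight_recr /ext ltnn addn0; apply: eq_weight => i ->. Qed.

Definition repb b (P : pt) := exists c N n, rep c N n P /\ (weight c N + 2 * N <= b + `|P.2|)%N.

(** An [a] step changes one digit by 1. A [t] step that leaves the levels adds an empty level at
    cost 2, but it also moves away from 0, so that the right-hand side grows by 2 as well. *)
Lemma repb_step b P s : repb b P -> repb b.+1 (step P s).
Proof.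
case: P => x k [c [N [n [r /= cost]]]].
have [/= nN kn xE] := r.
case: s => [[] e] /=.
  have kp : (absz (k + n%:Z)%R <= N)%N by lia.
  exists (upd c (absz (k + n%:Z)%R) (sgn e)), N, n; split.
    by apply: (rep_upd r kp); congr (_ + _ * pow2 _); lia.
  have := weight_upd_le c (sgn e) kp; have : `|sgn e|%N = 1%N by case: e.
  by move=> /=; lia.
have e1 : `|sgn e|%N = 1%N by case: (e).
have [kk|kk] := boolP (- n%:Z <= k + sgn e <= N%:Z - n%:Z).
  exists c, N, n; split; first exact: rep_k r _.
  by move=> /=; lia.
case: e e1 kk => /= _ kk.
  exists (fun i => if i is j.+1 then c j else 0), N.+1, n.+1; split.
    by apply: (rep_bot r); lia.
  by rewrite weight_bot /=; lia.
exists (ext c N), N.+1, n; split.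
  by apply: (rep_top r); lia.
by rewrite weight_top /=; lia.
Qed.

(** Converse of [len_le_rep], by following the path letter by letter; together they give the length
    formula. *)
Lemma len_le_repb b P : len_le b P -> repb b P.
Proof.
suff H n Q T : reach n Q T -> forall b, repb b Q -> repb (b + n) T.
  move=> /H/(_ 0%N); rewrite add0n; apply; exists (fun=> 0), 0%N, 0%N; split=> //.
    by split=> //=; rewrite dsum0 mul0r.
  by rewrite weight0.
elim=> [{}n {}P|{}n {}P s {}Q _ _ IH] {}b.
  by case=> c [N [m [r cost]]]; exists c, N, m; split=> //; lia.
by move=> /(repb_step s)/IH; rewrite addSnnS.
Qed.

(** * Minimal expansions *)

Definition has_len r P := len_le r P /\ forall b, len_le b P -> (r <= b)%N.
Definition best r c N n (P : pt) := [/\ rep c N n P, weight c N + 2 * N = r + `|P.2|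
   & forall b, len_le b P -> (r <= b)%N]%N.

Lemma has_len_best r P : has_len r P -> exists c N n, best r c N n P.
Proof.
case=> /len_le_repb [c [N [n [rP cost]]]] mn; exists c, N, n; split=> //.
have [nN kn _] := rP.
suff H : len_le (weight c N + 2 * N - `|P.2|)%N P by have := mn _ H; lia.
by apply: (len_le_rep rP); lia.
Qed.

Section Best.
Variables (r : nat) (c : nat -> int) (N n : nat) (x : rat) (k : int).
Hypothesis bst : best r c N n (x, k).

Let rP : rep c N n (x, k). Proof. by case: bst. Qed.
Let cost : (weight c N + 2 * N = r + `|k|)%N. Proof. by case: bst. Qed.
Let mn b : len_le b (x, k) -> (r <= b)%N. Proof. by case: bst => _ _; apply. Qed.

(** Source of the digit conditions below: each violation yields a cheaper expansion. *)
Lemma best_min c' N' n' : rep c' N' n' (x, k) -> (r + `|k| <= weight c' N' + 2 * N')%N.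
Proof.
move=> rP'; have := rP' => -[/= nN' kn' _].
suff H : len_le (weight c' N' + 2 * N' - `|k|)%N (x, k) by have := mn H; lia.
by apply: (len_le_rep rP') => /=; lia.
Qed.

(* Otherwise carry: [2 * 2 ^ i = 2 ^ i.+1]. *)
Lemma best_digit i : (i < N)%N -> (`|c i| <= 1)%N.
Proof.
move=> iN; rewrite leqNgt; apply/negP => ci.
pose e := sgz (c i).
have iN' := ltnW iN.
have r1 := rep_upd (d := - 2 * e) rP iN' erefl.
have r2 : rep (upd (upd c i (- 2 * e)) i.+1 e) N n (x, k).
  apply: (rep_upd r1) => //; rewrite (_ : i.+1%:Z - n%:Z = (i%:Z - n%:Z) + 1) ?pow2S; last by lia.
  by rewrite intrM; ring.
have := best_min r2; have := weight_upd_le (upd c i (- 2 * e)) e iN.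
by have := weight_upd c (- 2 * e) iN'; rewrite /e; lia.
Qed.

(* Otherwise [6 * 2 ^ N = 3 * 2 ^ N.+1] pays for the two steps to a new level. *)
Lemma best_top : (`|c N| <= 5)%N.
Proof.
rewrite leqNgt; apply/negP => cN; pose e := sgz (c N).
have [nN kn _] := rP; rewrite /= in kn.
have r1 := rep_upd (d := - 6 * e) rP (leqnn N) erefl.
have r2 := rep_top r1 (k' := k).
have r3 : rep (upd (ext (upd c N (- 6 * e)) N) N.+1 (3 * e)) N.+1 n (x, k).
  apply: (rep_upd (r2 _)) => //; first by lia.
  rewrite (_ : N.+1%:Z - n%:Z = (N%:Z - n%:Z) + 1) ?pow2S; last by lia.
  by rewrite !intrM; ring.
have := best_min r3; have := weight_upd_le (ext (upd c N (- 6 * e)) N) (3 * e) (leqnn N.+1).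
by rewrite weight_top; have := weight_upd c (- 6 * e) (leqnn N); rewrite /e; lia.
Qed.

(* Otherwise [2 ^ N = 2 * 2 ^ N.-1] saves the two steps to the top level. *)
Lemma best_top_ge2 : (n < N)%N -> k < N%:Z - n%:Z -> (2 <= `|c N|)%N.
Proof.
move=> nN kN; rewrite leqNgt; apply/negP => cN.
case EN: N nN kN => [//|M] nM kM; rewrite EN in cN.
have [_ kn xE] := rP; rewrite /= EN in kn xE.
have r1 : rep (upd c M (2 * c M.+1)) M n (x, k).
  split=> //=; first by lia.
  by rewrite xE dsum_upd // dsum_recr exprS; congr (_%:~R * _); ring.
have := best_min r1; have := weight_upd_le c (2 * c M.+1) (leqnn M).
by move: cost; rewrite EN weight_recr; lia.
Qed.

(** Otherwise the bottom digit [2 * z] becomes [z] one level higher and the bottom level disappears;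
    the hypotheses keep 0 and [k] among the remaining levels. *)
Lemma best_bot_odd z : (0 < n)%N -> - n%:Z < k -> c 0%N <> 2 * z.
Proof.
move=> n0 nk c0; have [nN kn xE] := rP; rewrite /= in kn xE.
case EN: N nN kn xE => [|M] nM kn xE; first by lia.
case En: n n0 nk nM kn xE => [//|m] _ nk nM kn xE.
have r1 : rep (upd (c \o succn) 0 z) M m (x, k).
  split=> //=; first by lia.
  rewrite xE dsum_upd // dsum_recl c0 (_ : - m%:Z = - m.+1%:Z + 1) ?pow2S ?expr0; last by lia.
  by rewrite mulr1 -mulrDr intrM addrC; ring.
have := best_min r1; have := weight_upd_le (c \o succn) z (leq0n M).
by move: cost; rewrite EN weight_recl c0; lia.
Qed.

(** Hence [r + |k| <= 3 * N + 5], so that a large [r] forces many levels. *)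
Lemma best_weight_le : (weight c N <= N + 5)%N.
Proof.
have := best_top; have : forall i, (i < N)%N -> (`|c i| <= 1)%N by apply: best_digit.
case: (N) => [|M] H; first by rewrite weight0.
rewrite weight_recr; suff : (weight c M <= M.+1)%N by lia.
rewrite /weight -[leqRHS](card_ord M.+1) -sum1_card; apply: leq_sum => i _; exact: H.
Qed.

(** A depth beyond the denominator of [x] would make the bottom digit even, against
    [best_bot_odd]. *)
Lemma best_depth_le q z : x = z%:~R * pow2 (- q%:Z) -> (q < n)%N -> - q%:Z <= k -> False.
Proof.
move=> xz qn qk; have [nN kn xE] := rP; rewrite /= in kn xE.
have [z' zE] := dsum_parity c N.
have E : dsum c N = z * 2 ^+ (n - q).
  have t0 := pow2_gt0 (- n%:Z).
  have : (dsum c N)%:~R * pow2 (- n%:Z) = (z * 2 ^+ (n - q))%:~R * pow2 (- n%:Z).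
    rewrite -xE xz intrM -pow2_nat (_ : - q%:Z = (n - q)%N%:Z - n%:Z) ?pow2D ?mulrA //; lia.
  by move/mulIf => /(_ (lt0r_neq0 t0))/eqP; rewrite eqr_int => /eqP.
case En: (n - q)%N E => [|m]; first by lia.
rewrite zE exprS => E.
by apply: (@best_bot_odd (z * 2 ^+ m - z')); lia.
Qed.

End Best.

(** * First letters of geodesics *)

Lemma bwalk_share r s P Q : (0 < r)%N -> len_le 1 s -> reach r.-1 s P -> reach r.-1 s Q ->
  bwalk r (2 * r - 2) P Q.
Proof.
move=> r0 Ls sP sQ; rewrite (_ : (2 * r - 2 = r.-1 + r.-1)%N); last by lia.
apply: (walk_trans (Q := s)); first apply: bwalk_sym; apply: bwalk_geo Ls _ _ => //; lia.
Qed.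

Lemma len_le_t (e : bool) : len_le 1 (0, sgn e).
Proof. by have := @reach_t (sgn e) 0 0 _ erefl; case: e. Qed.

Lemma len_le_a (e : bool) : len_le 1 ((sgn e)%:~R, 0).
Proof. by have := @reach_a (sgn e) 0 0 _ erefl; rewrite add0r mulr1; case: e. Qed.

Section Start.
Variables (r : nat) (c : nat -> int) (N n : nat) (x : rat) (k : int).
Hypothesis bst : best r c N n (x, k).

Let rP : rep c N n (x, k). Proof. by case: bst. Qed.
Let cost : (weight c N + 2 * N = r + `|k|)%N. Proof. by case: bst. Qed.

(** For [0 <= k] a shortest tour visits the bottom first. Left multiplication by [t] keeps the
    digits and lowers the depth by one. *)
Lemma start_tV : 0 <= k -> (0 < n)%N -> reach r.-1 (0, -1) (x, k).
Proof.
move=> k0; case: n rP => [//|m] [/= mN kN ->] _.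
have r1 : rep c N m ((dsum c N)%:~R * pow2 (- m%:Z), k + 1) by split=> //=; lia.
apply: reach_L; [apply: (len_le_rep r1) => /=| |]; [lia| |lia].
by rewrite add0r mulrCA -pow2D; congr (_ * pow2 _); lia.
Qed.

(** For [k <= 0] the top is visited first; left multiplication by the inverse of [t] keeps the
    digits and raises the depth by one. *)
Lemma start_t : k <= 0 -> (n < N)%N -> reach r.-1 (0, 1) (x, k).
Proof.
move=> k0 nN; have [_ /= kN ->] := rP.
have r1 : rep c N n.+1 ((dsum c N)%:~R * pow2 (- n.+1%:Z), k - 1) by split=> //=; lia.
apply: reach_L; [apply: (len_le_rep r1) => /=| |]; [lia| |lia].
by rewrite add0r mulrCA -pow2D; congr (_ * pow2 _); lia.
Qed.

Hypotheses (n0 : n = 0%N) (k0 : 0 <= k) (N2 : (2 <= N)%N).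

Lemma best_int : x = (dsum c N)%:~R.
Proof. by case: rP => _ _ /= ->; rewrite n0 oppr0 mulr1. Qed.

(** An even [x] has bottom digit 0, as this digit is at most 1 in absolute value, so level 0 can be
    left at once. *)
Lemma start_t_even z : 0 < k -> dsum c N = 2 * z -> reach r.-1 (0, 1) (x, k).
Proof.
move=> kp; have xE := best_int; have := cost; have := best_digit bst.
have [_ /= kn _] := rP; rewrite n0 in kn.
case: N N2 kn xE => [//|M] _ kn xE dg; rewrite dsum_recl => cst SE.
have {dg} c0 : c 0%N = 0 by have := dg _ (ltn0Sn M); lia.
have r1 : rep (c \o succn) M 0 (z%:~R, k - 1).
  by split=> //=; [lia|rewrite oppr0 mulr1; congr _%:~R; lia].
apply: reach_L; [apply: (len_le_rep r1) => /=| |].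
- by move: cst; rewrite weight_recl c0; lia.
- by rewrite xE dsum_recl SE intrM add0r.
- by lia.
Qed.

(* As [-1 + 2 = 1] and [-1 - 2 = 1 - 4], the residue of [x] modulo 4 selects a
   first digit that some geodesic uses. *)
Lemma start_a (e : bool) z : dsum c N = sgn e + 4 * z -> reach r.-1 ((sgn e)%:~R, 0) (x, k).
Proof.
move=> SE; have xE := best_int.
have [_ /= kn _] := rP; rewrite n0 in kn.
have g0 := best_digit bst (ltnW N2); have g1 := best_digit bst N2.
have W01 := @weight_ge2 c N 0 1 (leq0n N) (ltnW N2) isT.
(* Changes [d0], [d1], [d2] of the three lowest digits that sum to [- sgn e] remove the first
   letter; it remains to make them lower the weight. *)
have L_sub d0 d1 d2 : sgn e + d0 + 2 * d1 + 4 * d2 = 0 ->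
    (`|(c 0%N + d0)%R| + `|(c 1%N + d1)%R| + `|d2| < `|c 0%N| + `|c 1%N|)%N ->
    len_le r.-1 (x - (sgn e)%:~R, k).
  move=> E lt; have r1 : rep (upd (upd (upd c 0 d0) 1 d1) 2 d2) N 0 (x - (sgn e)%:~R, k).
    split=> //=; rewrite !dsum_upd // ?(ltnW N2) // xE oppr0 mulr1 -intrB.
    by congr _%:~R; rewrite expr0 expr1 (_ : 2 ^+ 2 = 4) //; lia.
  apply: (len_le_rep r1) => /=.
  have := weight_upd_le (upd (upd c 0 d0) 1 d1) d2 N2.
  have := weight_upd (upd c 0 d0) d1 (ltnW N2); have := weight_upd c d0 (leq0n N).
  by rewrite (_ : upd c 0 d0 1%N = c 1%N) //; lia.
suff HL : len_le r.-1 (x - (sgn e)%:~R, k).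
  by apply: reach_L HL _ _; [rewrite pow2_0 mul1r subrKC|lia].
have [w wE] : exists w, dsum c N = c 0%N + 2 * c 1%N + 4 * w.
  case: (N) N2 => [//|[//|M]] _; rewrite !dsum_recl /=.
  by exists (dsum ((c \o succn) \o succn) M); lia.
have e1 : sgn e = 1 \/ sgn e = -1 by case: (e); [right|left].
(* [c 0] is odd; if it is [- sgn e], the residue modulo 4 makes [c 1] odd too. *)
have [E|E] : c 0%N = sgn e \/ c 0%N = - sgn e by lia.
  by apply: (L_sub (- sgn e) 0 0); lia.
have [E1|E1] : c 1%N = sgn e \/ c 1%N = - sgn e by lia.
  by apply: (L_sub (sgn e) (- sgn e) 0); lia.
by apply: (L_sub (sgn e) (sgn e) (- sgn e)); lia.
Qed.

End Start.

(** * Nonnegative levels *)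

Lemma reach_at (d i : int) x k y l : y = x + d%:~R * pow2 k -> l = k + i ->
  reach (`|d| + `|i|) (x, k) (y, l).
Proof. by move=> /reach_a H1 /reach_t H2; apply: walk_trans H1 (H2 _). Qed.

(* Climb to the top level and lower the top digit by one; this leaves room to come
   down, change [x] into [y], climb again and restore the top digit. *)
Lemma detour_positive r c N c' N' x k y l (e : bool) (j : int) :
  best r c N 0 (x, k) -> best r c' N' 0 (y, l) -> (4 < N)%N -> (4 < N')%N ->
  0 <= k -> k <= j -> j <= l -> l <= 2 -> k < l \/ k = 1 /\ l = 1 ->
  y = x + (sgn e)%:~R * pow2 j ->
  bwalk r (2 * r - 2) (x, k) (y, l).
Proof.
move=> bx bY N4 N4' k0 kj jl l2 kl yE.
have cN := best_top_ge2 bx (ltn_trans (isT : 0 < 4)%N N4).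
have {}cN : (2 <= `|c N|)%N by apply: cN; lia.
case: bx => rx /= cx _; case: bY => ry /= cy _.
have e1 : `|sgn e|%N = 1%N by case: (e).
pose eps := sgz (c N); have eps1 : `|eps|%N = 1%N by rewrite /eps; lia.
(* Lowering the top digit pays for the change at level [j], so [c2] weighs no more than [c]. *)
pose c1 := upd c N (- eps); pose c2 := upd c1 `|j|%N (sgn e).
have W1 : (weight c1 N < weight c N)%N by have := weight_upd c (- eps) (leqnn N); rewrite /c1 /eps; lia.
have jN : (`|j| <= N)%N by lia.
have W2 : (weight c2 N <= weight c N)%N by have := weight_upd_le c1 (sgn e) jN; rewrite -/c2; lia.
have Wc := weight_ge c (leqnn N).
pose x1 := x + (- eps)%:~R * pow2 N%:Z; pose y1 := x1 + (sgn e)%:~R * pow2 j.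
have y1E : y = y1 + eps%:~R * pow2 N%:Z.
  by rewrite yE /y1 /x1 rmorphN; ring.
have r1 i : 0 <= i <= N%:Z -> rep c1 N 0 (x1, i).
  move=> iN; apply: rep_k (rep_upd rx (leqnn N) _) _; last by lia.
  by rewrite subr0.
have r2 i : 0 <= i <= N%:Z -> rep c2 N 0 (y1, i).
  move=> iN; apply: rep_upd (r1 i iN) jN _.
  by rewrite /y1 subr0; congr (_ + _ * pow2 _); lia.
have L1 b i : 0 <= i <= N%:Z -> (weight c1 N + 2 * N <= b + `|i|)%N -> len_le b (x1, i).
  by move=> /r1/len_le_rep; apply.
have L2 b i : 0 <= i <= N%:Z -> (weight c2 N + 2 * N <= b + `|i|)%N -> len_le b (y1, i).
  by move=> /r2/len_le_rep; apply.
have C1 : bwalk r (1 + N - `|k|) (x, k) (x1, N%:Z).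
  apply: bwalk_sym; apply: (bwalk_geo (i := (weight c1 N + N)%N)).
  - by apply: L1; lia.
  - apply: walk_mono; first apply: (@reach_at eps (k - N%:Z)); last by lia.
      by rewrite /x1 rmorphN; ring.
    by lia.
  - by lia.
have C2 : bwalk r (N - `|j|) (x1, N%:Z) (x1, j).
  apply: (bwalk_geo (i := (weight c1 N + N)%N)).
  - by apply: L1; lia.
  - by apply: walk_mono; [apply: (@reach_t (j - N%:Z))|]; lia.
  - by lia.
have C3 : bwalk r 1 (x1, j) (y1, j).
  apply: (bwalk_edge (b := (weight c1 N + 2 * N - `|j|)%N) (d := sgn e)) => //; last by lia.
  by apply: L1; lia.
have C4 : bwalk r (N - `|j|) (y1, j) (y1, N%:Z).
  apply: bwalk_sym; apply: (bwalk_geo (i := (weight c2 N + N)%N)).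
  - by apply: L2; lia.
  - by apply: walk_mono; [apply: (@reach_t (j - N%:Z))|]; lia.
  - by lia.
have C5 : bwalk r (1 + N - `|l|) (y1, N%:Z) (y, l).
  have C m : k < m -> m <= 2 -> bwalk r (1 + N - `|m|) (y1, N%:Z) (y, m).
    move=> km m2; apply: (bwalk_geo (i := (weight c2 N + N)%N)).
    - by apply: L2; lia.
    - by apply: walk_mono; [apply: (@reach_at eps (m - N%:Z))|]; rewrite ?y1E //; lia.
    - by lia.
  (* If [k = l = 1], the bound through [c2] only covers the descent to level 2; the last edge starts
     at [(y, 2)], which has length at most [r - 1]. *)
  case: kl => [kl|[k1 l1]]; first by apply: C.
  apply: (walk_mono (n := (1 + N - 2 + 1)%N)); last by lia.
  apply: walk_trans (C 2 _ _) _; [lia|lia|rewrite l1].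
  apply: (bwalk_geo (i := r.-1)); last by lia.
    by apply: (len_le_rep (rep_k ry _)) => /=; lia.
  exact: (@reach_t (-1)).
apply: walk_mono.
  apply: walk_trans C1 _; apply: walk_trans C2 _; apply: walk_trans C3 _.
  by apply: walk_trans C4 _; apply: C5.
by lia.
Qed.

Lemma close_int c N x k y d :
  rep c N 0 (x, k) -> 0 <= k -> y = x + d%:~R * pow2 k ->
  y = (dsum c N + d * 2 ^+ `|k|%N)%:~R.
Proof.
move=> [_ _ /= ->] k0 ->; rewrite oppr0 mulr1 intrD intrM -pow2_nat.
by congr (_ + _ * pow2 _); lia.
Qed.

(** If both tours go below level 0, both can start with the inverse of [t]. Otherwise [x] and [y]
    are integers whose residues modulo 4 decide the possible first letters; the detour remains for
    [k <= 1] and odd [y]. *)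
Lemma case_pos r c N n c' N' n' x k y l d : (200 < r)%N ->
  best r c N n (x, k) -> best r c' N' n' (y, l) ->
  0 <= k -> k <= l -> (`|d| <= 2)%N -> l - k <= 2 -> (l - k = 2 -> d = 0) ->
  y = x + d%:~R * pow2 k ->
  bwalk r (2 * r - 2) (x, k) (y, l).
Proof.
move=> r200 bx bY k0 kl d2 lk lkd yE; have r0 : (0 < r)%N by lia.
have tk : pow2 k = (2 ^+ `|k|%N)%:~R by rewrite -pow2_nat; congr pow2; lia.
have intn c0 N0 n0 z m (q : int) : best r c0 N0 n0 (z, m) -> 0 <= m -> z = q%:~R -> n0 = 0%N.
  move=> b m0 zq; case: n0 b => // n0 b.
  by case: (best_depth_le (q := 0) (z := q) b); rewrite ?oppr0 ?mulr1.
have [/andP[n0 n0']|n00] := boolP ((0 < n)%N && (0 < n')%N).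
  apply: (bwalk_share r0 (len_le_t true)); first exact: start_tV bx _ _.
  by apply: (start_tV bY); lia.
(* As [y - x] is an integer, [x] and [y] are integers together, and integers have depth 0. *)
have [En En'] : n = 0%N /\ n' = 0%N.
  have [En|En] : n = 0%N \/ n' = 0%N by lia.
    subst n; split=> //; case: bx => rx _ _.
    by apply: (intn _ _ _ _ _ _ bY _ (close_int rx k0 yE)); lia.
  subst n'; split=> //; apply: (intn _ _ _ _ _ (dsum c' N' - d * 2 ^+ `|k|%N) bx) => //.
  case: bY => [[_ _ /= yS] _ _]; rewrite intrB intrM -tk.
  by move: yS; rewrite oppr0 mulr1 => <-; rewrite yE addrK.
subst n n'.
have xS := best_int bx erefl; have yS := best_int bY erefl.
have ES : dsum c' N' = dsum c N + d * 2 ^+ `|k|%N.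
  by case: bx => rx _ _; apply/eqP; rewrite -(eqr_int rat) -yS -(close_int rx k0 yE).
have Wx := best_weight_le bx; have Wy := best_weight_le bY.
have [rx /= cx _] := bx; have [ry /= cy _] := bY.
have [_ /= kN _] := rx; have [_ /= lN _] := ry.
have N2 : (2 <= N)%N by lia.
have N2' : (2 <= N')%N by lia.
have st c0 N0 z m : best r c0 N0 0 (z, m) -> (2 <= N0)%N -> 0 <= m ->
    (m = 0 \/ exists q, dsum c0 N0 = 2 * q) -> reach r.-1 (0, 1) (z, m).
  move=> b N02 m0 [m1|[q Eq]]; first by apply: (start_t b); lia.
  have [m1|m1] := eqVneq m 0; first by apply: (start_t b); lia.
  by apply: (start_t_even b _ _ _ _ Eq); lia.
have share_t : (k = 0 \/ exists q, dsum c N = 2 * q) ->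
   (l = 0 \/ exists q, dsum c' N' = 2 * q) -> bwalk r (2 * r - 2) (x, k) (y, l).
  move=> H1 H2; apply: (bwalk_share r0 (len_le_t false)); first exact: st bx _ _ H1.
  by apply: st bY _ _ H2 => //; lia.
have share_a (e : bool) q q' : dsum c N = sgn e + 4 * q -> dsum c' N' = sgn e + 4 * q' ->
   bwalk r (2 * r - 2) (x, k) (y, l).
  move=> H1 H2; apply: (bwalk_share r0 (len_le_a e)); first exact: start_a bx _ _ _ _ _ H1.
  by apply: (start_a bY _ _ _ H2) => //; lia.
(* With a common residue modulo 4, both can start with [t] if it is even and with the same power of
   [a] if it is odd. *)
have share4 q : dsum c' N' = dsum c N + 4 * q -> bwalk r (2 * r - 2) (x, k) (y, l).
  move=> E4; have [|H|H] : [\/ exists z, dsum c N = 2 * z, exists z, dsum c N = 1 + 4 * z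
     | exists z, dsum c N = -1 + 4 * z].
  - have := divz_eq (dsum c N) 4; have := ltz_pmod (dsum c N) (isT : 0 < 4 :> int).
    have := modz_ge0 (dsum c N) (isT : 4 != 0 :> int).
    set u := (_ %/ _)%Z; set v := (_ %% _)%Z => v0 v4 E.
    have [v1|[v1|[v1|v1]]] : v = 0 \/ v = 1 \/ v = 2 \/ v = 3 by lia.
    + by apply: Or31; exists (2 * u); lia.
    + by apply: Or32; exists u; lia.
    + by apply: Or31; exists (2 * u + 1); lia.
    + by apply: Or33; exists (u + 1); lia.
  - by case=> z Hz; apply: share_t; right; [exists z|exists (z + 2 * q); lia].
  - by case: H => z Hz; apply: (share_a false _ (z + q) Hz) => /=; lia.
  - by case: H => z Hz; apply: (share_a true _ (z + q) Hz) => /=; lia.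
have [k2|k2] := leP 2 k.
  apply: (share4 (d * 2 ^+ (`|k| - 2)%N)); rewrite ES.
  have -> : (2 : int) ^+ `|k|%N = 4 * 2 ^+ (`|k| - 2)%N.
    by rewrite -[4]/((2 : int) ^+ 2) -exprD; congr (_ ^+ _); lia.
  by lia.
have N4 : (4 < N)%N by lia.
have N4' : (4 < N')%N by lia.
have [d0|d0] := eqVneq d 0; first by apply: (share4 0); rewrite ES d0; lia.
have evenodd (z : int) : (exists q, z = 2 * q) \/ exists q, z = 2 * q + 1.
  have := divz_eq z 2; have := ltz_pmod z (isT : 0 < 2 :> int).
  have := modz_ge0 z (isT : 2 != 0 :> int).
  set u := (_ %/ _)%Z; set v := (_ %% _)%Z => v0 v4 E.
  have [E0|E0] : v = 0 \/ v = 1 by lia.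
    by left; exists u; lia.
  by right; exists u; lia.
have dE (m : int) : `|d|%N = `|m|%N -> 0 < m -> d = sgn (d < 0) * m.
  by move=> dm m0; case: ltrP => /=; lia.
have [k1|k1] : k = 0 \/ k = 1 by lia.
  have {}ES : dsum c' N' = dsum c N + d by rewrite ES k1 expr0 mulr1.
  have [l1|l1] := eqVneq l 0; first by apply: share_t; left.
  have [ev|[q qE]] := evenodd (dsum c' N'); first by apply: share_t; [left|right].
  have [d1|d1] : `|d|%N = 1%N \/ `|d|%N = 2%N by lia.
    apply: (@detour_positive r c N c' N' x k y l (d < 0) 0) => //; try lia.
    by rewrite yE k1; congr (_ + _%:~R * _); rewrite [LHS](dE 1) ?mulr1.
  (* Two units of level 0 are one unit of level 1. *)
  apply: (@detour_positive r c N c' N' x k y l (d < 0) 1) => //; try lia.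
  by rewrite yE k1 [in LHS](dE 2) // intrM pow2_0 pow2_1; ring.
have {}ES : dsum c' N' = dsum c N + 2 * d by rewrite ES k1 expr1; ring.
have [[q dq]|[q dq]] := evenodd d; first by apply: (share4 q); rewrite ES; lia.
have [[q' ev]|[q' qE]] := evenodd (dsum c N).
  by apply: share_t; right; [exists q'|exists (q' + d); lia].
apply: (@detour_positive r c N c' N' x k y l (d < 0) 1) => //; try lia.
by rewrite yE k1; congr (_ + _%:~R * _); rewrite [LHS](dE 1) ?mulr1 //; lia.
Qed.

(** * Levels of opposite signs *)

(* If [x] is not an integer, geodesics to the two points tour the levels in
   opposite orders. Lowering the top digit and the bottom digit in turn makes it
   possible to cross level 0 inside the ball and to restore them afterwards. *)
Lemma case_mixed r c N n c' N' n' x : (200 < r)%N ->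
  best r c N n (x, 1) -> best r c' N' n' (x, -1) ->
  bwalk r (2 * r - 2) (x, 1) (x, -1).
Proof.
move=> r200 bx bY; have [rx /= cx _] := bx; have [ry /= cy my] := bY.
have [nN /= kn xE] := rx; have [nN' /= kn' yE] := ry.
(* If [n = 0], then [x] is an integer, so [n' = 1] with bottom digit 0; hence [(x, 0)], the point
   between the two, has length below [r]. *)
have [n0|n0] := posnP n.
  subst n; have n1 : n' = 1%N.
    suff : (n' <= 1)%N by lia.
    rewrite leqNgt; apply/negP => n1.
    apply: (best_depth_le (q := 1) (z := dsum c N * 2) bY) => //.
    by rewrite xE intrM -mulrA; congr (_ * _); rewrite oppr0; apply/esym/(pow2NK 1).
  subst n'; have SE : dsum c' N' = dsum c N * 2.
    apply/eqP; rewrite -(eqr_int rat) intrM.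
    have t0 := lt0r_neq0 (pow2_gt0 (-1)).
    apply/eqP/(mulIf t0); rewrite -yE xE -mulrA; congr (_ * _).
  have [z zE] := dsum_parity c' N'.
  have dg := best_digit bY (i := 0); have c0 : c' 0%N = 0 by lia.
  case: N' {bY dg zE kn'} ry cy nN' yE SE => [//|M] ry cy nN' yE SE.
  have rz : rep (c' \o succn) M 0 (x, 0).
    split=> //=; rewrite oppr0 mulr1 xE oppr0 mulr1; congr _%:~R.
    by move: SE; rewrite dsum_recl c0; lia.
  have Lz : len_le r.-1 (x, 0) by apply: (len_le_rep rz) => /=; move: cy; rewrite weight_recl c0; lia.
  apply: (walk_mono (n := (1 + 1)%N)); last by lia.
  apply: (walk_trans (Q := (x, 0))).
    by apply: bwalk_sym; apply: (bwalk_geo Lz (@reach_t 1 _ _ _ _)); lia.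
  by apply: (bwalk_geo Lz (@reach_t (-1) _ _ _ _)); lia.
(* The length formula sees only the absolute value of the final level. With -1 in place of 1,
   [best_top_ge2] applies even when the top level is 1. *)
have rx' : rep c N n (x, -1) by apply: rep_k rx _; lia.
have bx' : best r c N n (x, -1) by split.
have cN : (2 <= `|c N|)%N by apply: (best_top_ge2 bx'); lia.
have c0 : (`|c 0%N| = 1)%N.
  have := best_digit bx (i := 0); have := best_bot_odd bx (z := 0) n0; lia.
pose eps := sgz (c N); have eps1 : `|eps|%N = 1%N by rewrite /eps; lia.
pose eta := c 0%N; have N0 : (0 < N)%N by lia.
have WN0 := weight_ge2 c (leqnn N) (leq0n N) (lt0n_neq0 N0).
(* The path passes through [x1], [x2], [x3] in this order: top lowered, then bottom removed as well,
   then top restored. *)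
pose c1 := upd c N (- eps); pose c2 := upd c1 0 (- eta); pose c3 := upd c 0 (- eta).
have W1 : (weight c1 N + 1 = weight c N)%N by have := weight_upd c (- eps) (leqnn N); rewrite /c1 /eps; lia.
have W3 : (weight c3 N + 1 = weight c N)%N by have := weight_upd c (- eta) (leq0n N); rewrite /c3 /eta; lia.
have W2 : (weight c2 N + 2 = weight c N)%N.
  have := weight_upd c1 (- eta) (leq0n N); rewrite -/c2 (_ : c1 0%N = eta) /eta; first by lia.
  by rewrite /c1 /upd ifN // eq_sym; lia.
pose M : int := N%:Z - n%:Z; pose m : int := - n%:Z.
pose x1 := x + (- eps)%:~R * pow2 M; pose x2 := x1 + (- eta)%:~R * pow2 m.
pose x3 := x + (- eta)%:~R * pow2 m.
have x2E : x2 = x3 + (- eps)%:~R * pow2 M by rewrite /x2 /x1 /x3; ring.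
have r1 : rep c1 N n (x1, 1) by apply: (rep_upd rx (leqnn N)).
have r2 : rep c2 N n (x2, 1) by apply: (rep_upd r1 (leq0n N)); rewrite sub0r.
have r3 : rep c3 N n (x3, 1) by apply: (rep_upd rx (leq0n N)); rewrite sub0r.
have LL b c4 x4 i : rep c4 N n (x4, 1) -> m <= i <= M ->
    (weight c4 N + 2 * N <= b + `|i|)%N -> len_le b (x4, i).
  by move=> r4 im; apply: len_le_rep (rep_k r4 im).
have [M' EM] : exists M' : nat, M = M' by exists `|M|%N; lia.
have NM : N = (M' + n)%N by lia.
have C1 : bwalk r M' (x, 1) (x1, M).
  apply: bwalk_sym; apply: (bwalk_geo (i := (weight c N + 2 * N - M' - 1)%N)).
  - by apply: LL r1 _ _; lia.
  - apply: walk_mono; first apply: (@reach_at eps (1 - M)); last by lia.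
      by rewrite /x1 rmorphN; ring.
    by lia.
  - by lia.
have C2 : bwalk r M' (x1, M) (x1, 0).
  apply: (bwalk_geo (i := (weight c N + 2 * N - M' - 1)%N)).
  - by apply: LL r1 _ _; lia.
  - by apply: walk_mono; [apply: (@reach_t (- M))|]; lia.
  - by lia.
have C3 : bwalk r (1 + n) (x1, 0) (x2, m).
  apply: bwalk_sym; apply: (bwalk_geo (i := (weight c N + 2 * N - n - 2)%N)).
  - by apply: LL r2 _ _; lia.
  - apply: walk_mono; first apply: (@reach_at eta (- m)); last by lia.
      by rewrite /x2 rmorphN; ring.
    by lia.
  - by lia.
have C4 : bwalk r n (x2, m) (x2, 0).
  apply: (bwalk_geo (i := (weight c N + 2 * N - n - 2)%N)).
  - by apply: LL r2 _ _; lia.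
  - by apply: walk_mono; [apply: (@reach_t (- m))|]; lia.
  - by lia.
have C5 : bwalk r M' (x2, 0) (x2, M).
  apply: bwalk_sym; apply: (bwalk_geo (i := (weight c N + 2 * N - M' - 2)%N)).
  - by apply: LL r2 _ _; lia.
  - by apply: walk_mono; [apply: (@reach_t (- M))|]; lia.
  - by lia.
have C6 : bwalk r (1 + M') (x2, M) (x3, 0).
  apply: (bwalk_geo (i := (weight c N + 2 * N - M' - 2)%N)).
  - by apply: LL r2 _ _; lia.
  - apply: walk_mono; first apply: (@reach_at eps (- M)); last by lia.
      by rewrite x2E rmorphN; ring.
    by lia.
  - by lia.
have C7 : bwalk r n (x3, 0) (x3, m).
  apply: bwalk_sym; apply: (bwalk_geo (i := (weight c N + 2 * N - n - 1)%N)).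
  - by apply: LL r3 _ _; lia.
  - by apply: walk_mono; [apply: (@reach_t (- m))|]; lia.
  - by lia.
have C8 : bwalk r n (x3, m) (x, -1).
  apply: (bwalk_geo (i := (weight c N + 2 * N - n - 1)%N)).
  - by apply: LL r3 _ _; lia.
  - apply: walk_mono; first apply: (@reach_at eta (-1 - m)); last by lia.
      by rewrite /x3 rmorphN; ring.
    by lia.
  - by lia.
(* The pieces add up to [4 * N + 2], while [r = weight c N + 2 * N - 1] and the weight is at least
   3. *)
apply: walk_mono.
  apply: walk_trans C1 _; apply: walk_trans C2 _; apply: walk_trans C3 _.
  apply: walk_trans C4 _; apply: walk_trans C5 _; apply: walk_trans C6 _.
  by apply: walk_trans C7 _; apply: C8.
by lia.
Qed.

(** * Nonpositive levels *)

(* Hence changing [x] by at most [8 * 2 ^ h] at level [h] costs at most 2. *)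
Lemma two_digits (i : nat) : (i <= 8)%N -> exists (u v : int) (p q : nat),
  [/\ (p <= 3)%N, (q <= 3)%N, (`|u| + `|v| <= 2)%N & i%:Z = u * 2 ^+ p + v * 2 ^+ q].
Proof.
case: i => [|[|[|[|[|[|[|[|[|//]]]]]]]]] _.
- by exists 0, 0, 0%N, 0%N.
- by exists 1, 0, 0%N, 0%N.
- by exists 1, 0, 1%N, 0%N.
- by exists 1, 1, 1%N, 0%N.
- by exists 1, 0, 2%N, 0%N.
- by exists 1, 1, 2%N, 0%N.
- by exists 1, 1, 2%N, 1%N.
- by exists 1, (-1), 3%N, 0%N.
- by exists 1, 0, 3%N, 0%N.
Qed.

(** The starting point has length at most [r - 3], so by [two_digits] all points on the way have
    length at most [r - 1]. Three levels above [h] are needed for the digit of weight 8. *)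
Lemma climb r c N n x h (e : bool) (m : nat) : rep c N n (x, h) -> (3 <= r)%N ->
  (weight c N + 2 * N <= r - 3 + `|h|)%N -> h + 3 <= N%:Z - n%:Z -> (m <= 8)%N ->
  bwalk r m (x, h) (x + (sgn e * m%:Z)%:~R * pow2 h, h).
Proof.
move=> rx r3 cost hN; have [_ /= hn _] := rx.
have Li (i : nat) : (i <= 8)%N -> len_le r.-1 (x + (sgn e * i%:Z)%:~R * pow2 h, h).
  move=> /two_digits [u [v [p [q [p3 q3 uv ->]]]]].
  have pN : (`|(h + n%:Z)%R| + p <= N)%N by lia.
  have qN : (`|(h + n%:Z)%R| + q <= N)%N by lia.
  have tp s : (2 ^+ s)%:~R * pow2 h = pow2 ((`|(h + n%:Z)%R| + s)%N%:Z - n%:Z).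
    by rewrite -pow2_nat -pow2D; congr pow2; lia.
  have r1 := rep_upd (d := sgn e * u) rx pN erefl.
  have r2 := rep_upd (d := sgn e * v) r1 qN erefl.
  move: (weight_upd_le c (sgn e * u) pN) (weight_upd_le (upd c (`|(h + n%:Z)%R| + p) (sgn e * u)) (sgn e * v) qN) r2.
  set c1 := upd c _ _; set c2 := upd c1 _ _ => W1 W2 r2.
  suff -> : x + (sgn e * (u * 2 ^+ p + v * 2 ^+ q))%:~R * pow2 h =
     x + (sgn e * u)%:~R * pow2 ((`|(h + n%:Z)%R| + p)%N%:Z - n%:Z) +
     (sgn e * v)%:~R * pow2 ((`|(h + n%:Z)%R| + q)%N%:Z - n%:Z).
    by apply: (len_le_rep r2) => /=; move: W1 W2; case: (e) => /=; lia.
  by rewrite -!tp !(intrM, intrD); ring.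
elim: m => [|m IH] m8; first by rewrite mulr0 mul0r addr0; apply: walk0.
rewrite -addn1; apply: walk_trans (IH (ltnW m8)) _.
apply: (bwalk_edge (d := sgn e) (Li m (ltnW m8))); [lia|by case: (e)|].
by rewrite PoszD mulrDr mulr1 intrD; ring.
Qed.

Lemma dsum_split c s M :
  dsum c (s.+1 + M) = dsum c s + 2 ^+ s.+1 * dsum (fun i => c (s.+1 + i)%N) M.
Proof.
elim: M => [|M IH]; first by rewrite addn0 dsum_recr dsum0 addn0; ring.
by rewrite addnS dsum_recr IH dsum_recr addnS -addnS exprD; ring.
Qed.

Lemma weight_split c s M :
  weight c (s.+1 + M) = (weight c s + weight (fun i => c (s.+1 + i)%N) M)%N.
Proof.
elim: M => [|M IH]; first by rewrite addn0 weight_recr weight0 addn0.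
by rewrite addnS weight_recr IH weight_recr addnS addnA.
Qed.

Lemma dsum_lt c s : (forall i, (i <= s)%N -> (`|c i| <= 1)%N) -> `|dsum c s| < 2 ^+ s.+1.
Proof.
elim: s => [|s IH] cs; first by rewrite dsum0 expr1; have := cs 0%N (leqnn _); lia.
rewrite dsum_recr; have := IH (fun i hi => cs i (leqW hi)); have := cs s.+1 (leqnn _).
rewrite [in X in _ -> X](exprS _ s.+1); move: (2 ^+ s.+1) => t c1 St.
have [->|[->|->]] : c s.+1 = 0 \/ c s.+1 = 1 \/ c s.+1 = -1 by lia.
all: by lia.
Qed.

(** As [k <= -4], a shortest tour visits the top first and then descends, so it can be cut at level
    -3. The digits below the cut are at most 1 in absolute value and sum to less than one unit of
    level -3. *)
Lemma high_part r c N n x k : best r c N n (x, k) -> k <= -4 ->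
  exists (z : int) (i j : nat), [/\ len_le i (z%:~R * pow2 (-3), -3),
    reach j (z%:~R * pow2 (-3), -3) (x, k), (i + j = r)%N, (3 <= i)%N /\ (1 <= j)%N
    & `|x - z%:~R * pow2 (-3)| < pow2 (-3)].
Proof.
move=> bx k4; have [[nN /= kn xE] /= cost _] := bx.
have [s ns] : exists s, n = s.+4 by exists (n - 4)%N; lia.
have [M NM] : exists M, N = (s.+1 + M)%N by exists (N - s.+1)%N; lia.
have tn : pow2 (- n%:Z) = pow2 (-3) * pow2 (- s.+1%:Z) by rewrite -pow2D; congr pow2; lia.
have ts : (2 ^+ s.+1)%:~R * pow2 (- s.+1%:Z) = 1 by rewrite -pow2_nat pow2NK.
pose z := dsum (fun i => c (s.+1 + i)%N) M.
have xz : x = z%:~R * pow2 (-3) + pow2 (-3) * ((dsum c s)%:~R * pow2 (- s.+1%:Z)).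
  rewrite xE NM dsum_split tn -/z intrD intrM mulrDl addrC; congr (_ + _); last by ring.
  transitivity (z%:~R * pow2 (-3) * ((2 ^+ s.+1)%:~R * pow2 (- s.+1%:Z))); first by ring.
  by rewrite ts mulr1.
exists z, (weight (fun i => c (s.+1 + i)%N) M + 2 * M - 3)%N, (weight c s + 2 * s.+1 - `|(k + 3)%R|)%N.
rewrite NM weight_split in cost.
split; [| |lia|lia|].
- have r1 : rep (fun i => c (s.+1 + i)%N) M 3 (z%:~R * pow2 (-3), -3) by split=> //=; lia.
  by apply: (len_le_rep r1) => /=; lia.
- have r1 : rep (ext c s) s.+1 s.+1 ((dsum c s)%:~R * pow2 (- s.+1%:Z), k + 3).
    split=> //=; first by lia.
    rewrite dsum_recr /ext ltnn mul0r addr0; congr (_%:~R * _); apply/esym/eq_dsum => i ->//.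
  apply: (reach_L (k := k + 3) _ xz); last by lia.
  by apply: (len_le_rep r1); rewrite weight_top /=; lia.
- rewrite xz [X in `|X|](_ : _ = pow2 (-3) * ((dsum c s)%:~R * pow2 (- s.+1%:Z))); last by ring.
  rewrite normrM (gtr0_norm (pow2_gt0 _)) gtr_pMr ?pow2_gt0 //.
  rewrite normrM (gtr0_norm (pow2_gt0 _)) -[X in _ < X]ts ltr_pM2r ?pow2_gt0 //.
  rewrite -intr_norm ltr_int.
  by apply: dsum_lt => i si; apply: (best_digit bx); lia.
Qed.

(* Both geodesics descend through level [-3], at points which differ by at most 2
   horizontal edges. *)
Lemma case_low r c N n c' N' n' x k y l d :
  best r c N n (x, k) -> best r c' N' n' (y, l) ->
  k <= -4 -> l <= -6 -> (`|d| <= 2)%N -> y = x + d%:~R * pow2 l ->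
  bwalk r (2 * r - 2) (x, k) (y, l).
Proof.
move=> bx bY k4 l6 d2 yE.
have [z [i [j [Lz zx ij [i3 j1] xz]]]] := high_part bx k4.
have [z' [i' [j' [Lz' zy ij' [i3' j1'] yz]]]] : exists (z : int) (i j : nat), [/\ len_le i (z%:~R * pow2 (-3), -3),
    reach j (z%:~R * pow2 (-3), -3) (y, l), (i + j = r)%N, (3 <= i)%N /\ (1 <= j)%N
    & `|y - z%:~R * pow2 (-3)| < pow2 (-3)] by apply: (high_part bY); lia.
(* In units of level -3, each cut-off part is below 1 and [y - x] is at most 1/4. *)
have D2 : (`|(z' - z)%R| <= 2)%N.
  have tl : 0 < pow2 l <= pow2 (-3) / 8.
    rewrite pow2_gt0 /=; have -> : pow2 (-3) / 8 = pow2 (-6) by [].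
    by rewrite /pow2 ler_eXz2l.
  have dl : `|d%:~R * pow2 l| <= pow2 (-3) / 4.
    rewrite normrM -intr_norm (gtr0_norm (pow2_gt0 _)).
    have : (`|d|%:~R : rat) <= 2 by rewrite -[2]/(2%:~R) ler_int; lia.
    by move: tl; move: (_%:~R : rat) (pow2 l) (pow2 (-3)) => a b t; nra.
  have t0 := pow2_gt0 (-3).
  suff : `|z' - z| < 3 by lia.
  rewrite -(ltr_int rat) intr_norm -(ltr_pM2r t0) -{1}(gtr0_norm t0) -normrM intrB.
  move: xz yz dl t0; rewrite yE; move: (d%:~R * _) (z%:~R : rat) (z'%:~R : rat) (pow2 _) => a b b' t.
  rewrite !ltr_norml !ler_norml => /andP[? ?] /andP[? ?] /andP[? ?] ?.
  by apply/andP; split; lra.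
(* Since only [1 <= j] and [1 <= j'] are known, each side can afford one horizontal edge. *)
have [D1 [D3 [DE D1le D3le DD]]] : exists D1 D3 : int, [/\ z' - z = D1 - D3, (`|D1| <= 1)%N, (`|D3| <= 1)%N
    & (`|D1| + `|D3| <= 2)%N].
  have [h|[h|[h|[h|h]]]] : z' - z = 0 \/ z' - z = 1 \/ z' - z = 2 \/ z' - z = -1 \/ z' - z = -2 by lia.
  - by exists 0, 0; split=> //; lia.
  - by exists 1, 0; split=> //; lia.
  - by exists 1, (-1); split=> //; lia.
  - by exists (-1), 0; split=> //; lia.
  - by exists (-1), 1; split=> //; lia.
have C1 : bwalk r j (x, k) (z%:~R * pow2 (-3), -3).
  by apply: bwalk_sym; apply: bwalk_geo Lz zx _; lia.
have C2 : bwalk r `|D1|%N (z%:~R * pow2 (-3), -3) ((z + D1)%:~R * pow2 (-3), -3).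
  by apply: (bwalk_geo Lz (reach_a _)); [rewrite intrD; ring|lia].
have C3 : bwalk r `|D3|%N ((z + D1)%:~R * pow2 (-3), -3) (z'%:~R * pow2 (-3), -3).
  apply: bwalk_sym; apply: (bwalk_geo Lz' (reach_a _)); last by lia.
  by rewrite (_ : z + D1 = z' + D3) ?intrD; [ring|lia].
have C4 : bwalk r j' (z'%:~R * pow2 (-3), -3) (y, l) by apply: bwalk_geo Lz' zy _; lia.
apply: walk_mono.
  by apply: walk_trans C1 _; apply: walk_trans C2 _; apply: walk_trans C3 _; apply: C4.
by lia.
Qed.

(* Near level 0 either both geodesics can start with [t], or [x] has a digit far
   below [k]; then one can go down three levels, walk horizontally and climb. *)
Lemma case_neg r c N n c' N' n' x k y l d : (200 < r)%N ->
  best r c N n (x, k) -> best r c' N' n' (y, l) ->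
  l <= k -> k <= 0 -> l < 0 -> (`|d| <= 2)%N -> k - l <= 2 -> (k - l = 2 -> d = 0) ->
  y = x + d%:~R * pow2 l ->
  bwalk r (2 * r - 2) (x, k) (y, l).
Proof.
move=> r200 bx bY lk k0 l0 d2 kl kld yE.
have [l6|l6] := leP l (-6); first by apply: (case_low bx bY _ _ d2 yE); lia.
have [/andP[nN nN']|nN] := boolP ((n < N)%N && (n' < N')%N).
  apply: (bwalk_share _ (len_le_t false)); [lia| |]; first exact: start_t bx _ _.
  by apply: (start_t bY); lia.
have [rx /= cx _] := bx; have [ry /= cy _] := bY.
have [nN1 /= kn xE] := rx; have [nN1' /= kn' yS] := ry.
have Wx := best_weight_le bx; have Wy := best_weight_le bY.
have dy c0 N0 n0 z m : rep c0 N0 n0 (z, m) -> (n0 <= 9)%N -> exists q : int, z = q%:~R * pow2 (-9).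
  move=> [_ _ /= ->] n9; exists (dsum c0 N0 * 2 ^+ (9 - n0)); rewrite intrM -pow2_nat -mulrA -pow2D.
  by congr (_ * pow2 _); lia.
have tl : pow2 l = (2 ^+ `|(9 + l)%R|%N)%:~R * pow2 (-9).
  by rewrite -pow2_nat -pow2D; congr pow2; lia.
(* A tour without levels above 0 has large depth because [N] is large. As [l > -6], [y - x] is a
   multiple of [2 ^ -9], so the other depth exceeds 9 as well. *)
have [n9 n9'] : (9 < n)%N /\ (9 < n')%N.
  have [Nn|Nn] : N = n \/ N' = n' by lia.
    split; first by lia.
    rewrite ltnNge; apply/negP => /(dy _ _ _ _ _ ry) [q qE].
    apply: (best_depth_le (q := 9) (z := q - d * 2 ^+ `|(9 + l)%R|%N) bx); [|lia|lia].
    by rewrite intrB intrM mulrBl -mulrA -tl -qE yE addrK.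
  split; last by lia.
  rewrite ltnNge; apply/negP => /(dy _ _ _ _ _ rx) [q qE].
  apply: (best_depth_le (q := 9) (z := q + d * 2 ^+ `|(9 + l)%R|%N) bY); [|lia|lia].
  by rewrite intrD intrM mulrDl -mulrA -tl -qE yE.
pose h := k - 3; pose w : nat := `|(l - h)%R|%N.
pose D : int := d * 2 ^+ w.
have yD : y = x + D%:~R * pow2 h.
  by rewrite yE /D intrM -pow2_nat -mulrA -pow2D; congr (_ + _ * pow2 _); rewrite /w; lia.
have rxh : rep c N n (x, h) by apply: rep_k rx _; lia.
have ryh : rep c' N' n' (y, h) by apply: rep_k ry _; lia.
(* As [k <= 0], ending the same tour three levels lower saves three steps. *)
have C1 : bwalk r 3 (x, k) (x, h).
  apply: bwalk_sym; apply: (bwalk_geo (i := (r - 3)%N)); last by lia.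
    by apply: (len_le_rep rxh) => /=; lia.
  by apply: (@reach_t 3); lia.
have C3 : bwalk r 3 (y, h) (y, l).
  apply: (walk_mono (n := w)); last by lia.
  apply: (bwalk_geo (i := (r - w)%N)); last by lia.
    by apply: (len_le_rep ryh) => /=; lia.
  by apply: reach_t; lia.
suff C2 : bwalk r 16 (x, h) (y, h).
  by apply: walk_mono; [apply: walk_trans C1 _; apply: walk_trans C2 _; apply: C3|lia].
have sgD : D = sgn (D < 0) * `|D|%N%:Z by case: ltrP => /=; lia.
have [D8|D8] := leqP `|D|%N 8.
  apply: (walk_mono (n := `|D|%N)); last by lia.
  by rewrite yD {2}sgD; apply: (climb _ rxh); lia.
(* More than 8 edges occur only for [|d| = 2] and [w = 3]; then there are 16, and each end covers
   8. *)
have [lk' dd] : l = k /\ `|d|%N = 2%N.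
  have [w3|[w2|w1]] : (w = 3 \/ w = 2 \/ w = 1)%N by lia.
  - by move: D8; rewrite /D w3; lia.
  - by move: D8; rewrite /D w2; lia.
  - by move: D8; rewrite /D w1; lia.
have D16 : `|D|%N = 16%N by rewrite /D /w lk' (_ : `|(k - h)%R|%N = 3%N); lia.
apply: (@walk_trans _ 8 8 _ (x + (sgn (D < 0) * 8%N%:Z)%:~R * pow2 h, h)).
  by apply: (climb _ rxh); lia.
apply: bwalk_sym; have -> : x + (sgn (D < 0) * 8%N%:Z)%:~R * pow2 h = y + (sgn (~~ (D < 0)) * 8%N%:Z)%:~R * pow2 h.
  rewrite yD {2}sgD D16 sgnN -addrA -mulrDl -intrD; congr (_ + _%:~R * _); lia.
by apply: (climb _ ryh); lia.
Qed.

(** * Nearby points of a sphere: assembling the cases *)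

(** The unit is that of the lower level: an [a] step combined with a [t] step can amount to two such
    units. A level change by 2 uses up both letters. *)
Definition close P Q := exists d : int, [/\ (`|d| <= 2)%N, (`|(P.2 - Q.2)%R| <= 2)%N,
  `|(P.2 - Q.2)%R|%N = 2%N -> d = 0 & Q.1 = P.1 + d%:~R * pow2 (Num.min P.2 Q.2)].

Lemma close_sym P Q : close P Q -> close Q P.
Proof.
case: P Q => x k [y l] [d [/= d2 h h' ->]]; exists (- d); split=> /=; [lia|lia|lia|].
by rewrite minC rmorphN; ring.
Qed.

Lemma reachI n P Q : reach n P Q ->
  P = Q \/ exists m s, n = m.+1 /\ reach m (step P s) Q.
Proof. by case=> [{}n {}P|{}n {}P s {}Q _ w]; [left|right; exists n, s]. Qed.

Lemma reach2_close P Q : reach 2 P Q -> close P Q.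
Proof.
case: P => x k; have e1 e : `|sgn e|%N = 1%N by case: e.
move=> /reachI [<-|[m [s [[<-] /reachI [<-|[m' [s' [[<-] /reachI [<-|[? [? []//]]]]]]]]]]].
- by exists 0; split=> //=; [lia|rewrite mul0r addr0].
- case: s => [[] e]; have E1 := e1 e; rewrite /close /=.
    by exists (sgn e); split; [lia|lia|lia|by rewrite minxx].
  by exists 0; split=> //; [lia|rewrite mul0r addr0].
- case: s s' => [[] e] [[] e']; have E1 := e1 e; have E2 := e1 e'; rewrite /close /=.
  + by exists (sgn e + sgn e'); split; [lia|lia|lia|by rewrite minxx intrD; ring].
  + case: e' E2 => /= E2.
      exists (2 * sgn e); split; [lia|lia|lia|].
      have -> : pow2 k = 2 * pow2 (Num.min k (k - 1)) by rewrite -pow2S; congr pow2; lia.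
      by rewrite intrM; ring.
    exists (sgn e); split; [lia|lia|lia|].
    by congr (_ + _ * pow2 _); lia.
  + case: e E1 => /= E1.
      exists (sgn e'); split; [lia|lia|lia|].
      by congr (_ + _ * pow2 _); lia.
    exists (2 * sgn e'); split; [lia|lia|lia|].
    by rewrite pow2S (_ : Num.min _ _ = k) ?intrM; [ring|lia].
  + by exists 0; split=> //; [lia|rewrite mul0r addr0].
Qed.

Lemma bwalk_near r P Q : (200 < r)%N -> has_len r P -> has_len r Q -> close P Q ->
  bwalk r (2 * r - 2) P Q.
Proof.
move=> r200; wlog lk : P Q / Q.2 <= P.2.
  move=> H eP eQ PQ; have [lk|/ltW lk] := leP Q.2 P.2; first exact: H.
  by apply: bwalk_sym; apply: H => //; apply: close_sym.
case: P Q lk => x k [y l] /= lk /has_len_best[c [N [n bx]]] /has_len_best[c' [N' [n' bY]]].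
case=> d [/= d2 kl kld]; rewrite min_r // => yE.
have [l0|l0] := leP 0 l.
  apply: bwalk_sym; apply: (@case_pos r c' N' n' c N n y l x k (- d)) => //; try lia.
  by rewrite yE rmorphN; ring.
have [k0|k0] := leP k 0; first by apply: (case_neg r200 bx bY) yE => //; lia.
(* Levels of strictly opposite signs that differ by at most 2 can only be 1 and -1. *)
have [k1 l1 d0] : [/\ k = 1, l = -1 & d = 0] by split; lia.
subst k l d; rewrite mul0r addr0 in yE; subst y.
exact: case_mixed r200 bx bY.
Qed.

(** * From the affine model to BS(1,2) *)

Notation R12 := [:: bs12_relation].

Definition run P (w : gword bs_letter) : pt := foldl step P w.

Lemma run_eq u v : pres_eq R12 u v -> forall P, run P u = run P v.
Proof.
elim=> {u v} [//|u v _ IH P|u v w _ IH _ IH' P|u u' v v' _ IH _ IH' P|a e P|u v].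
- by rewrite IH.
- by rewrite IH IH'.
- by rewrite /run !foldl_cat -/(run P u) IH -/(run _ v) IH'.
- exact: (stepK P (a, e)).
- rewrite inE => /eqP[-> ->] [x k] /=.
  by congr pair; rewrite ?addrK // pow2S; ring.
Qed.

Definition phi (g : BS12) : pt := run (0, 0) (repr g).

Lemma phi_class u : phi (pres_class R12 u) = run (0, 0) u.
Proof. exact: run_eq (pres_repr_class _ _) _. Qed.

Definition gen (s : bs_letter * bool) : BS12 := pres_class R12 [:: s].

Lemma phi_gen g s : phi (g * gen s)%g = step (phi g) s.
Proof. by rewrite -{1}(pres_reprK g) -pres_classM phi_class /run foldl_cat. Qed.

Lemma phi1 : phi 1%g = (0, 0).
Proof. by rewrite -pres_class_nil phi_class. Qed.

Lemma gen_aF : gen (bs_letter_a, false) = bs_a. Proof. by []. Qed.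
Lemma gen_tF : gen (bs_letter_t, false) = bs_t. Proof. by []. Qed.
Lemma gen_aT : gen (bs_letter_a, true) = (bs_a^-1)%g.
Proof. exact: pres_class_inv_gen. Qed.
Lemma gen_tT : gen (bs_letter_t, true) = (bs_t^-1)%g.
Proof. exact: pres_class_inv_gen. Qed.

(** * Normal forms and faithfulness of the affine action *)

Section NormalForm.
Variables (G : groupType) (a t : G).
Local Open Scope group_scope.
Hypothesis ta : t * a = a ^+ 2 * t.

(** The integer exponent of [a] is split as [p - q] to stay within natural powers. *)
Definition nf (i p q l : nat) : G := t ^- i * (a ^+ p * a ^- q) * t ^+ l.

Lemma t_a p : t * a ^+ p = a ^+ (2 * p) * t.
Proof.
elim: p => [|p IH]; first by rewrite muln0 !expg0 mulg1 mul1g.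
by rewrite expgSr mulgA IH -mulgA ta mulgA -[in LHS]expgnDr mulnS addnC.
Qed.

Lemma tn_a l p : t ^+ l * a ^+ p = a ^+ (2 ^ l * p) * t ^+ l.
Proof.
elim: l => [|l IH]; first by rewrite expn0 mul1n !expg0 mulg1 mul1g.
by rewrite expgS -mulgA IH mulgA t_a -mulgA expnS mulnA.
Qed.

Lemma tn_aV l p : t ^+ l * a ^- p = a ^- (2 ^ l * p) * t ^+ l.
Proof.
apply: (mulgI (a ^+ (2 ^ l * p))); rewrite mulgA -tn_a -mulgA mulgV mulg1.
by rewrite mulVKg.
Qed.

Lemma a_ratio p q p' q' : (p + q' = p' + q)%N ->
  a ^+ p * a ^- q = a ^+ p' * a ^- q'.
Proof.
move=> E; apply: (mulIg (a ^+ q * a ^+ q')).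
have C : a ^+ q * a ^+ q' = a ^+ q' * a ^+ q by rewrite -!expgnDr addnC.
rewrite [in RHS]C -!mulgA !mulKg -!expgnDr E //.
Qed.

(** Corresponds to expanding a dyadic fraction by [2 ^ m]. *)
Lemma nf_shift i p q l m : nf i p q l = nf (i + m) (2 ^ m * p) (2 ^ m * q) (l + m).
Proof.
rewrite /nf (addnC l) !expgnDr !invgM.
have -> : t ^- m * t ^- i = t ^- i * t ^- m by rewrite -!invgM -!expgnDr addnC.
rewrite -!mulgA; congr (_ * _); rewrite [a ^- _ * (t ^+ m * _)]mulgA -tn_aV.
by rewrite !mulgA -[_ * _ * t ^+ m]mulgA -tn_a !mulgA mulVg mul1g.
Qed.

Lemma nf_t i p q l : nf i p q l * t = nf i p q l.+1.
Proof. by rewrite /nf expgSr !mulgA. Qed.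

Lemma nf_tV i p q l : nf i p q l * t^-1 = nf (i + 1) (2 ^ 1 * p) (2 ^ 1 * q) l.
Proof. by rewrite (nf_shift i p q l 1) [(l + 1)%N]addn1 -nf_t mulgK. Qed.

Lemma nf_a i p q l : nf i p q l * a = nf i (p + 2 ^ l) q l.
Proof.
rewrite /nf -!mulgA; congr (_ * _).
have -> : t ^+ l * a = a ^+ (2 ^ l) * t ^+ l by have := tn_a l 1; rewrite muln1.
rewrite !mulgA; congr (_ * _); rewrite expgnDr -!mulgA; congr (_ * _).
apply: (mulgI (a ^+ q)); apply: (mulIg (a ^+ q)).
by rewrite mulVKg -!mulgA mulVg mulg1 -!expgnDr addnC.
Qed.

Lemma nf_aV i p q l : nf i p q l * a^-1 = nf i p (q + 2 ^ l) l.
Proof.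
apply: (mulIg a); rewrite mulgVK nf_a /nf; congr (_ * _ * _).
by apply: a_ratio; rewrite addnAC addnA.
Qed.

End NormalForm.

Notation bnf := (nf bs_a bs_t).

Lemma bs_ta : (bs_t * bs_a = bs_a ^+ 2 * bs_t)%g.
Proof. by rewrite -bs12_relE mulgVK. Qed.

Lemma nfP (g : BS12) : exists i p q l, g = bnf i p q l.
Proof.
rewrite -(pres_reprK g); elim/last_ind: (repr g) => [|w s [i [p [q [l IH]]]]].
  by exists 0%N, 0%N, 0%N, 0%N; rewrite /nf !expg0 invg1 !mulg1.
rewrite -cats1 pres_classM IH -/(gen s); case: s => [[] []].
- by exists i, p, (q + 2 ^ l)%N, l; rewrite gen_aT nf_aV //; apply: bs_ta.
- by exists i, (p + 2 ^ l)%N, q, l; rewrite gen_aF nf_a //; apply: bs_ta.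
- by exists (i + 1)%N, (2 ^ 1 * p)%N, (2 ^ 1 * q)%N, l; rewrite gen_tT nf_tV //; apply: bs_ta.
- by exists i, p, q, l.+1; rewrite gen_tF nf_t.
Qed.

Lemma iter_step_t P e n :
  iter n (step^~ (bs_letter_t, e)) P = (P.1, P.2 + sgn e * n%:Z).
Proof.
elim: n => [|n IH] /=; first by rewrite mulr0 addr0; case: P.
by rewrite IH /= -addn1 PoszD; congr pair; ring.
Qed.

Lemma iter_step_a P e n :
  iter n (step^~ (bs_letter_a, e)) P = (P.1 + (sgn e * n%:Z)%:~R * pow2 P.2, P.2).
Proof.
elim: n => [|n IH] /=; first by rewrite mulr0 mul0r addr0; case: P.
by rewrite IH /= -addn1 PoszD mulrDr mulr1 intrD; congr pair; ring.
Qed.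

Lemma phi_gen_n g s n : phi (g * gen s ^+ n)%g = iter n (step^~ s) (phi g).
Proof. by elim: n => [|n IH]; rewrite ?mulg1 // expgSr mulgA phi_gen IH. Qed.

Lemma phi_nf i p q l : phi (bnf i p q l) = ((p%:Z - q%:Z)%:~R * pow2 (- i%:Z), l%:Z - i%:Z).
Proof.
rewrite /nf !mulgA -!expVgn -gen_tF -gen_aF -gen_tT -gen_aT -[(gen _ ^+ i)%g]mul1g.
rewrite !phi_gen_n phi1 !(iter_step_t, iter_step_a) /=; congr pair; last by ring.
by rewrite !mul1r !mulN1r !add0r rmorphN intrD; ring.
Qed.

Lemma phi_inj : injective phi.
Proof.
move=> g h; have [i [p [q [l ->]]]] := nfP g; have [i' [p' [q' [l' ->]]]] := nfP h.
rewrite !phi_nf => -[E El].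
(* Both normal forms are brought to the common denominator [2 ^ (i + i')]. *)
rewrite (nf_shift bs_ta i p q l i') (nf_shift bs_ta i' p' q' l' i) /nf (addnC i).
have -> : (l + i' = l' + i)%N by lia.
congr (_ * _)%g; congr (_ * _)%g; apply: a_ratio.
suff : (p%:Z - q%:Z) * 2 ^+ i' = (p'%:Z - q'%:Z) * 2 ^+ i.
  have two s : (2 : int) ^+ s = (2 ^ s)%N by rewrite -natz natrX.
  by rewrite !two => H; lia.
apply/eqP; rewrite -(eqr_int rat) !intrM -!pow2_nat; apply/eqP.
have t0 := lt0r_neq0 (pow2_gt0 (- i%:Z - i'%:Z)); apply: (mulIf t0).
rewrite -!mulrA -!pow2D.
rewrite (_ : i'%:Z + _ = - i%:Z); last by ring.
by rewrite (_ : i%:Z + _ = - i'%:Z) //; ring.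
Qed.

(** * Paths and distances in the Cayley graph *)

Lemma gen_inv_letter s : gen (inv_letter s) = ((gen s)^-1)%g.
Proof. by case: s => [[] []]; rewrite /inv_letter /= ?gen_aT ?gen_tT ?invgK. Qed.

Lemma bs_gensP x : reflect (exists s, x = gen s) (x \in bs_gens).
Proof.
apply: (iffP idP) => [|[[[] []] ->]]; rewrite ?gen_aT ?gen_tT !inE ?eqxx ?orbT //.
case/or4P => /eqP ->; [exists (bs_letter_a, false)|exists (bs_letter_a, true)
  |exists (bs_letter_t, false)|exists (bs_letter_t, true)] => //.
  by rewrite gen_aT.
by rewrite gen_tT.
Qed.

Lemma adj_gen g h : cayley_adj bs_gens g h -> exists s, h = (g * gen s)%g.
Proof.
case/orP => /bs_gensP[s E]; first by exists s; rewrite -E mulVKg.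
by exists (inv_letter s); rewrite gen_inv_letter -E invgM invgK mulVKg.
Qed.

Lemma path_reach g p : path (cayley_adj bs_gens) g p ->
  reach (size p) (phi g) (phi (last g p)).
Proof.
elim: p g => [|h p IH] g /=; first by move=> _; apply: walk0.
case/andP => /adj_gen[s E] /IH; rewrite E phi_gen => w.
by apply: (@walkS _ _ _ s).
Qed.

(** [E] is carried along edge by edge, so that [inner] can later certify that whole edges lie in the
    ball. *)
Lemma walk_path E n P Q g : walk E n P Q -> phi g = P ->
  exists p, [/\ (size p <= n)%N, path (cayley_adj bs_gens) g p, phi (last g p) = Q
    & forall u v, (u, v) \in zip (g :: p) p -> E (phi u) (phi v)].
Proof.
move=> w; elim: w g => [{}n {}P|{}n {}P s {}Q Es _ IH] g gP.
  by exists [::]; split.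
have [|p [pn pp lp Ep]] := IH (g * gen s)%g; first by rewrite phi_gen gP.
exists ((g * gen s)%g :: p); split=> //=.
  rewrite pp andbT /cayley_adj mulKg; apply/orP; left.
  by apply/bs_gensP; exists s.
move=> u v; rewrite inE => /predU1P[[-> ->]|/Ep//].
by rewrite phi_gen gP.
Qed.

Lemma dist_reach g h : reach (dist bs_gens g h) (phi g) (phi h).
Proof.
have [[p /andP[pp /eqP <-] <-] _] := dist_spec g h bs_gens_generates.
exact: path_reach.
Qed.

Lemma dist_le n g h : reach n (phi g) (phi h) -> (dist bs_gens g h <= n)%N.
Proof.
move=> /walk_path/(_ erefl)[p [pn pp lp _]].
have [_ H] := dist_spec g h bs_gens_generates.
by apply: leq_trans (H p _) pn; rewrite /edge_path pp (phi_inj lp) eqxx.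
Qed.

Lemma len_le_dist n g : len_le n (phi g) -> (dist bs_gens 1%g g <= n)%N.
Proof. by move=> Lg; apply: dist_le; rewrite phi1. Qed.

Lemma has_len_dist g : has_len (dist bs_gens 1%g g) (phi g).
Proof.
split; last by move=> b; apply: len_le_dist.
by have := dist_reach 1%g g; rewrite phi1.
Qed.

Lemma joined_sphere (R : realType) r (g h : BS12) : (200 < r)%N ->
  dist bs_gens 1%g g = r -> dist bs_gens 1%g h = r -> (dist bs_gens g h <= 2)%N ->
  joined_in_ball bs_gens r (2 * r%:R - 2 : R) g h.
Proof.
move=> r200 dg dh gh.
have eg := has_len_dist g; have eh := has_len_dist h; rewrite dg in eg; rewrite dh in eh.
have gh2 : reach 2 (phi g) (phi h) by apply: walk_mono (dist_reach g h) gh.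
have /walk_path/(_ erefl)[p [pn pp lp Ep]] := bwalk_near r200 eg eh (reach2_close gh2).
exists p; split.
- by rewrite /edge_path pp (phi_inj lp) eqxx.
- move=> u v /Ep uv [[u' v'] t] [/= [-> ->] /andP[t0 t1]].
  rewrite /ball1 /dist1_point /= ge_min.
  have rE : r%:R = r.-1%:R + 1 :> R by rewrite natr1 prednK //; lia.
  (* Every point of an edge is within 1 of the end at distance at most [r - 1]. *)
  rewrite rE; case: uv => /len_le_dist; rewrite -(ler_nat R) => d.
    by apply/orP; left; apply: lerD.
  by apply/orP; right; rewrite lerD // gerBl.
- by rewrite lerBrDr -natrM -natrD ler_nat; lia.
Qed.

Theorem theorem3p5 (R : realType) :
  MprimeAC bs_gens R /\
  (forall (r : nat) (w u : seq BS12),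
     (200 < r)%N ->
     geodesic bs_gens w -> size w = r ->
     geodesic bs_gens u -> size u = r ->
     (1 <= dist bs_gens (wordval w) (wordval u) <= 2)%N ->
     joined_in_ball bs_gens r (2 * r%:R - 2 : R) (wordval w) (wordval u)).
Proof.
split.
  by exists 201 => r a b r201 Sa Sb ab; apply: joined_sphere.
move=> r w u r200 [_ dw] wr [_ du] ur /andP[_ wu].
by apply: joined_sphere; rewrite -?dw -?du.
Qed.
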